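(* A scheme is étale if and only if it has a finite open cover by standard étale schemes.
   Context: We work in homotopy type theory with univalent universes and propositional truncation (neither excluded middle nor the axiom of choice is assumed). ''Merely'', ''there exists'', ''has'' and disjunction refer to propositional truncation; a map is surjective if its fibers are merely inhabited. Fix a commutative ring $R$. A finitely presented $R$-algebra is one merely of the form $R[X_1,\dots,X_n]/(P_1,\dots,P_l)$; for such $A$, $\mathrm{Spec}(A)$ is the type of $R$-algebra homomorphisms $A\to R$, and for $a:A$, $x:\mathrm{Spec}(A)$ one writes $a(x)=x(a)$. A Zariski-cover of $\mathrm{Spec}(A)$ is a finite family of subtypes $U_i=\{x\mid f_i(x)\text{ invertible}\}$ with $f_1,\dots,f_n:A$ generating the unit ideal. Axioms: (Locality) $R$ is local: $1\neq 0$, and if $x+y$ is invertible then $x$ or $y$ is invertible. (Duality) For every finitely presented $R$-algebra $A$ the map $A\to(\mathrm{Spec}(A)\to R)$, $a\mapsto(\varphi\mapsto\varphi(a))$ is an isomorphism of $R$-algebras. (Zariski-local choice) For every finitely presented $R$-algebra $A$ and family $B$ of merely inhabited types over $\mathrm{Spec}(A)$, there merely exist a Zariski-cover $U_1,\dots,U_n$ of $\mathrm{Spec}(A)$ and dependent functions $s_i:(x:U_i)\to B(x)$. A proposition is open if it is merely of the form $r_1\neq 0\vee\dots\vee r_n\neq 0$ with $r_i:R$, and closed if merely of the form $r_1=0\wedge\dots\wedge r_n=0$. A subtype $U$ of a type $X$ is open if $x\in U$ is an open proposition for all $x:X$. An affine scheme is a type merely of the form $\mathrm{Spec}(A)$ with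 $A$ a finitely presented $R$-algebra; a scheme is a type that merely has a finite cover by open subtypes that are affine schemes. A closed proposition is dense (closed dense) if it is merely of the form $r_1=0\wedge\dots\wedge r_n=0$ with all $r_i$ nilpotent. A type $X$ is formally étale if for every closed dense proposition $P$ the map $X\to X^P$ sending $x$ to the constant map is an equivalence. An étale scheme is a scheme which is formally étale as a type. A standard étale scheme is an affine scheme (merely) of the form $\mathrm{Spec}(R[X_1,\dots,X_n]/(P_1,\dots,P_n))$ where the determinant of $\left(\frac{\partial P_i}{\partial X_j}\right)_{1\leq i,j\leq n}$ is invertible in $R[X_1,\dots,X_n]/(P_1,\dots,P_n)$. *)

(* Defs.v *)
From HB Require Import structures.
From Stdlib Require Import Ring Ring_theory HLevels Setoid Morphisms.
From mathcomp Require Import all_boot fingroup perm.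

Set Implicit Arguments.
Unset Strict Implicit.
Unset Printing Implicit Defensive.

(** * The ambient type theory

    Rocq's [Type] and [eq] play the roles of the universes and of the identity
    type; types are not assumed to be sets.  Of homotopy type theory we
    postulate what is listed in [HoTT].

    - [merely] is propositional truncation.  It is kept abstract:
      [inhabited], [exists] and [\/] eliminate into every [Prop], identity types
      included, so that declaring them to be h-propositions would force all
      types to be sets.  For this reason mere existence and disjunction are
      expressed below with [merely], [{x & _}] and [+], never with [exists]
      or [\/].  Letting [merely] land in [Prop] amounts to propositional
      resizing and spares us the bookkeeping of universe levels.
    - [funext] and [propext] are the consequences of univalence for functions
      and for h-propositions.  Full univalence is not postulated: here [eq] on
      a large type is a small, impredicative [Prop], which conflicts with it. *)

Class HoTT := {
  merely : Type -> Prop;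
  merely_intro : forall A : Type, A -> merely A;
  merely_hprop : forall A : Type, IsHProp (merely A);
  merely_elim : forall A P : Type, IsHProp P -> (A -> P) -> merely A -> P;
  funext : forall (A : Type) (B : A -> Type) (f g : forall x, B x),
    (forall x, f x = g x) -> f = g;
  propext : forall P Q : Prop, IsHProp P -> IsHProp Q -> (P <-> Q) -> P = Q
}.

Definition IsContr (A : Type) : Type := {c : A | forall x, c = x}.

Definition IsEquiv (A B : Type) (f : A -> B) : Type :=
  forall b, IsContr {a : A | f a = b}.

Definition Equiv (A B : Type) : Type := {f : A -> B & IsEquiv f}.

Record hProp := HProp { holds :> Prop; holds_hprop : IsHProp holds }.

(** * Commutative rings and algebras

    The algebraic structures of MathComp require decidable equality on the
    carrier, which fails for the base ring [R]. *)

Record CommRing := {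
  car :> Type;
  car_set : IsHSet car;
  zero : car;
  one : car;
  add : car -> car -> car;
  mul : car -> car -> car;
  sub : car -> car -> car;
  opp : car -> car;
  cring_th : ring_theory zero one add mul sub opp (@eq car)
}.

Arguments zero {c}.
Arguments one {c}.
Arguments add {c}.
Arguments mul {c}.
Arguments sub {c}.
Arguments opp {c}.

Declare Scope cring_scope.
Delimit Scope cring_scope with CR.
Notation "0" := zero : cring_scope.
Notation "1" := one : cring_scope.
Notation "x + y" := (add x y) : cring_scope.
Notation "x * y" := (mul x y) : cring_scope.
Notation "x - y" := (sub x y) : cring_scope.
Notation "- x" := (opp x) : cring_scope.

Section RingLaws.
Context (A : CommRing).
Add Ring A_ring : (cring_th A).
Local Open Scope cring_scope.

Lemma addA : associative (@add A). Proof. move=> x y z; ring. Qed.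
Lemma addC : commutative (@add A). Proof. move=> x y; ring. Qed.
Lemma add0 : left_id zero (@add A). Proof. move=> x; ring. Qed.
Lemma mulA : associative (@mul A). Proof. move=> x y z; ring. Qed.
Lemma mulC : commutative (@mul A). Proof. move=> x y; ring. Qed.
Lemma mul1 : left_id one (@mul A). Proof. move=> x; ring. Qed.
End RingLaws.

HB.instance Definition _ (A : CommRing) :=
  Monoid.isComLaw.Build A zero (@add A) (@addA A) (@addC A) (@add0 A).
HB.instance Definition _ (A : CommRing) :=
  Monoid.isComLaw.Build A one (@mul A) (@mulA A) (@mulC A) (@mul1 A).

Local Open Scope cring_scope.

Definition IsUnit (A : CommRing) (x : A) : Type := {y : A | x * y = 1}.

Definition power (A : CommRing) (x : A) (k : nat) : A := iter k (mul x) 1.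

Definition det (A : CommRing) (n : nat) (M : 'I_n -> 'I_n -> A) : A :=
  \big[add/0]_(s : {perm 'I_n})
    ((if odd_perm s then opp 1 else 1) * \big[mul/1]_(i < n) M i (s i)).

Record IsRingHom (A B : CommRing) (f : A -> B) : Prop := {
  hom_one : f 1 = 1;
  hom_add : forall x y, f (x + y) = f x + f y;
  hom_mul : forall x y, f (x * y) = f x * f y
}.

Record Algebra (R : CommRing) := {
  alg :> CommRing;
  scal : R -> alg;
  scal_hom : IsRingHom scal
}.

Lemma id_hom (R : CommRing) : IsRingHom (fun x : R => x).
Proof. by []. Qed.

Definition regular (R : CommRing) : Algebra R :=
  {| alg := R; scal := fun r => r; scal_hom := id_hom R |}.

Definition AlgHom (R : CommRing) (A B : Algebra R) : Type :=
  {f : A -> B | IsRingHom f /\ forall r : R, f (scal A r) = scal B r}.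

Definition AlgIso (R : CommRing) (A B : Algebra R) : Type :=
  {f : AlgHom A B & IsEquiv (sval f)}.

Definition Spec (R : CommRing) (A : Algebra R) : Type := AlgHom A (regular R).

Definition value (R : CommRing) (A : Algebra R) (a : A) (x : Spec A) : R :=
  sval x a.

(** * Set quotients *)

Lemma hset_of_rel (A : Type) (E : A -> A -> Prop) :
  (forall x, E x x) -> (forall x y, IsHProp (E x y)) ->
  (forall x y, E x y -> x = y) -> IsHSet A.
Proof.
move=> Erefl Ehprop Eeq x.
pose c y (p : x = y) : x = y :=
  Logic.eq_trans (Logic.eq_sym (Eeq x x (Erefl x)))
           (Eeq x y (eq_ind x (E x) (Erefl x) y p)).
have cid y (p : x = y) : c y p = p.
  by case: y / p; rewrite /c /=; exact: Logic.eq_trans_sym_inv_l.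
move=> y p q; rewrite -(cid y p) -(cid y q) /c.
by rewrite (Ehprop _ _ (eq_ind x (E x) (Erefl x) y p) (eq_ind x (E x) (Erefl x) y q)).
Qed.

Lemma sig_eq (A : Type) (P : A -> Prop) (Phprop : forall x, IsHProp (P x))
  (u v : {x : A | P x}) : sval u = sval v -> u = v.
Proof.
case: u v => [x p] [y q] /= exy; case: y / exy q => q.
by rewrite (Phprop x p q).
Qed.

Section Quotient.
Context {H : HoTT} (T : Type) (E : T -> T -> Prop) (Eeqv : Equivalence E).

Definition eqclass (a b : T) : Prop := merely (E a b).

Definition Quot : Type := {S : T -> Prop | merely {a : T | S = eqclass a}}.

Definition class (a : T) : Quot := exist _ (eqclass a) (merely_intro (exist _ a erefl)).

Lemma eqclassP a b : merely (E a b) -> eqclass a = eqclass b.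
Proof.
move=> Eab; apply: funext => c; apply: propext; try exact: merely_hprop.
split; apply: merely_elim; try exact: merely_hprop.
- move=> Eac; move: Eab; apply: merely_elim; first exact: merely_hprop.
  by move=> Eab; apply: merely_intro; transitivity a => //; symmetry.
- move=> Ebc; move: Eab; apply: merely_elim; first exact: merely_hprop.
  by move=> Eab; apply: merely_intro; transitivity b.
Qed.

Lemma Quot_eq (u v : Quot) : sval u = sval v -> u = v.
Proof. by apply: sig_eq => S; apply: merely_hprop. Qed.

Lemma class_eq a b : E a b -> class a = class b.
Proof. by move=> Eab; apply/Quot_eq/eqclassP/merely_intro. Qed.

Lemma class_eff a b : class a = class b -> merely (E a b).
Proof.
move=> ab; have : sval (class b) b by apply: merely_intro; reflexivity.
by rewrite -ab.
Qed.

Lemma Quot_ind (P : Quot -> Type) :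
  (forall u, IsHProp (P u)) -> (forall a, P (class a)) -> forall u, P u.
Proof.
move=> Phprop Pclass [S s]; apply: (merely_elim _ _ s); first exact: Phprop.
move=> [a Sa]; have -> : exist _ S s = class a by apply: Quot_eq.
exact: Pclass.
Qed.

Lemma Quot_set : IsHSet Quot.
Proof.
have hp (w : Quot) b : IsHProp (sval w b).
  case: w => S /=; apply: merely_elim => [p q|[a ->]]; last exact: merely_hprop.
  by apply: funext => x; apply: funext => y; apply: hset_hprop.
apply: (@hset_of_rel Quot (fun u v => forall b, sval u b <-> sval v b)) => //.
- move=> u v p q; apply: funext => b; case: (p b) (q b) => [p1 p2] [q1 q2].
  by congr conj; apply: funext => x; apply: hp.
- by move=> u v uv; apply: Quot_eq; apply: funext => b; apply: propext; [exact: hp|exact: hp|].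
Qed.

Section Rec.
Context (B : Type) (Bset : IsHSet B) (f : T -> B).
Hypothesis fE : forall a b, E a b -> f a = f b.

Lemma Quot_rec_graph (u : Quot) :
  {b : B | merely {a : T | class a = u /\ f a = b}}.
Proof.
elim/Quot_ind: u => [u [b bP] [c cP]|a]; last by exists (f a); apply: merely_intro; exists a.
apply: sig_eq => [x|/=]; first exact: merely_hprop.
apply: (merely_elim _ _ bP) => [|[a [au <-]]]; first exact: Bset.
apply: (merely_elim _ _ cP) => [|[a' [a'u <-]]]; first exact: Bset.
have /class_eff : class a = class a' by rewrite au.
by apply: merely_elim; [exact: Bset|exact: fE].
Qed.

Definition Quot_rec (u : Quot) : B := sval (Quot_rec_graph u).

Lemma Quot_recE a : Quot_rec (class a) = f a.
Proof.
rewrite /Quot_rec; case: (Quot_rec_graph _) => b bP /=.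
apply: (merely_elim _ _ bP) => [|[a' [a'a <-]]]; first exact: Bset.
by move/class_eff: a'a; apply: merely_elim; [exact: Bset|exact: fE].
Qed.
End Rec.
End Quotient.

Section QuotientRing.
Context {H : HoTT} (T : Type) (E : T -> T -> Prop) (Eeqv : Equivalence E).
Context (o i : T) (p m s : T -> T -> T) (n : T -> T).
Context (Eext : ring_eq_ext p m n E) (Eth : ring_theory o i p m s n E).

Let Q := Quot E.
Let cl : T -> Q := @class H T E.

Definition lift1 (f : T -> T) (fE : Proper (E ==> E) f) : Q -> Q :=
  Quot_rec Eeqv (@Quot_set _ _ _) (fun a b ab => class_eq Eeqv (fE a b ab)).

Lemma lift2_proper (f : T -> T -> T) (fE : Proper (E ==> E ==> E) f) (v : Q) a b :
  E a b ->
  lift1 (fE a a (reflexivity a)) v = lift1 (fE b b (reflexivity b)) v.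
Proof.
move=> ab; elim/Quot_ind: v => [v|c]; first exact: Quot_set.
by rewrite /lift1 !Quot_recE; apply: class_eq => //; apply: fE => //; reflexivity.
Qed.

Definition lift2 (f : T -> T -> T) (fE : Proper (E ==> E ==> E) f) (u v : Q) : Q :=
  Quot_rec Eeqv (@Quot_set _ _ _) (lift2_proper fE v) u.

Lemma lift1E f fE a : @lift1 f fE (cl a) = cl (f a).
Proof. exact: Quot_recE. Qed.

Lemma lift2E f fE a b : @lift2 f fE (cl a) (cl b) = cl (f a b).
Proof. by rewrite /lift2 Quot_recE lift1E. Qed.

Definition qadd := lift2 (Radd_ext Eext).
Definition qmul := lift2 (Rmul_ext Eext).
Definition qopp := lift1 (Ropp_ext Eext).

Lemma quot_ring_theory :
  ring_theory (cl o) (cl i) qadd qmul (fun u v => qadd u (qopp v)) qopp (@eq Q).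
Proof.
split.
- elim/Quot_ind => [u|a]; first exact: Quot_set.
  by rewrite /qadd !lift2E; apply: class_eq => //; apply: (Radd_0_l Eth).
- elim/Quot_ind => [u|a]; first by move=> ? ?; apply: funext => ?; apply: Quot_set.
  elim/Quot_ind => [u|b]; first exact: Quot_set.
  by rewrite /qadd !lift2E; apply: class_eq => //; apply: (Radd_comm Eth).
- elim/Quot_ind => [u|a]; first by do 2!move=> ?; do 2!apply: funext => ?; apply: Quot_set.
  elim/Quot_ind => [u|b]; first by move=> ? ?; apply: funext => ?; apply: Quot_set.
  elim/Quot_ind => [u|c]; first exact: Quot_set.
  by rewrite /qadd !lift2E; apply: class_eq => //; apply: (Radd_assoc Eth).
- elim/Quot_ind => [u|a]; first exact: Quot_set.
  by rewrite /qmul !lift2E; apply: class_eq => //; apply: (Rmul_1_l Eth).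
- elim/Quot_ind => [u|a]; first by move=> ? ?; apply: funext => ?; apply: Quot_set.
  elim/Quot_ind => [u|b]; first exact: Quot_set.
  by rewrite /qmul !lift2E; apply: class_eq => //; apply: (Rmul_comm Eth).
- elim/Quot_ind => [u|a]; first by do 2!move=> ?; do 2!apply: funext => ?; apply: Quot_set.
  elim/Quot_ind => [u|b]; first by move=> ? ?; apply: funext => ?; apply: Quot_set.
  elim/Quot_ind => [u|c]; first exact: Quot_set.
  by rewrite /qmul !lift2E; apply: class_eq => //; apply: (Rmul_assoc Eth).
- elim/Quot_ind => [u|a]; first by do 2!move=> ?; do 2!apply: funext => ?; apply: Quot_set.
  elim/Quot_ind => [u|b]; first by move=> ? ?; apply: funext => ?; apply: Quot_set.
  elim/Quot_ind => [u|c]; first exact: Quot_set.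
  by rewrite /qmul /qadd !lift2E; apply: class_eq => //; apply: (Rdistr_l Eth).
- by [].
- elim/Quot_ind => [u|a]; first exact: Quot_set.
  by rewrite /qadd /qopp lift1E lift2E; apply: class_eq => //; apply: (Ropp_def Eth).
Qed.

Definition QuotRing : CommRing :=
  {| car := Q; car_set := @Quot_set _ _ _; cring_th := quot_ring_theory |}.

Lemma classD a b : cl (p a b) = (cl a : QuotRing) + cl b.
Proof. by symmetry; apply: lift2E. Qed.

Lemma classM a b : cl (m a b) = (cl a : QuotRing) * cl b.
Proof. by symmetry; apply: lift2E. Qed.

Lemma classN a : cl (n a) = - (cl a : QuotRing).
Proof. by symmetry; apply: lift1E. Qed.
End QuotientRing.

(** * Quotients by finitely generated ideals *)

Definition in_ideal {H : HoTT} (A : CommRing) (l : nat) (g : 'I_l -> A) (x : A) : Prop :=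
  merely {c : 'I_l -> A | x = \big[add/0]_(i < l) (c i * g i)}.

Section QuotientAlgebra.
Context {H : HoTT} (R : CommRing) (A : Algebra R) (l : nat) (g : 'I_l -> A).
Add Ring A_ring : (cring_th A).

Lemma in_ideal0 : in_ideal g 0.
Proof.
apply: merely_intro; exists (fun=> 0).
elim/big_rec: _ => // i x _ <-; ring.
Qed.

Lemma in_idealD x y : in_ideal g x -> in_ideal g y -> in_ideal g (x + y).
Proof.
apply: merely_elim => [? ?|[c ->]]; first by apply: funext => ?; apply: merely_hprop.
apply: merely_elim => [|[d ->]]; first exact: merely_hprop.
apply: merely_intro; exists (fun i => c i + d i); rewrite -big_split /=.
by apply: eq_bigr => i _; ring.
Qed.

Lemma in_idealM z x : in_ideal g x -> in_ideal g (z * x).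
Proof.
apply: merely_elim => [|[c ->]]; first exact: merely_hprop.
apply: merely_intro; exists (fun i => z * c i).
elim/big_rec2: _ => [|i a b _ <-]; ring.
Qed.

Definition eq_mod (x y : A) : Prop := in_ideal g (x - y).

Lemma eq_mod_equiv : Equivalence eq_mod.
Proof.
split.
- by move=> x; rewrite /eq_mod (_ : x - x = 0); [exact: in_ideal0|ring].
- move=> x y xy; rewrite /eq_mod (_ : y - x = opp 1 * (x - y)); last by ring.
  exact: in_idealM.
- move=> x y z xy yz; rewrite /eq_mod (_ : x - z = (x - y) + (y - z)); last by ring.
  exact: in_idealD.
Qed.

Lemma eq_mod_ext : ring_eq_ext (@add A) mul opp eq_mod.
Proof.
split.
- move=> x x' xx' y y' yy'; rewrite /eq_mod.
  rewrite (_ : _ - _ = (x - x') + (y - y')); last by ring.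
  exact: in_idealD.
- move=> x x' xx' y y' yy'; rewrite /eq_mod.
  rewrite (_ : _ - _ = y * (x - x') + x' * (y - y')); last by ring.
  by apply: in_idealD; apply: in_idealM.
- move=> x x' xx'; rewrite /eq_mod (_ : _ - _ = opp 1 * (x - x')); last by ring.
  exact: in_idealM.
Qed.

Lemma eq_mod_th : ring_theory 0 1 (@add A) mul sub opp eq_mod.
Proof.
have e x y : x = y -> eq_mod x y by move=> ->; case: eq_mod_equiv => r _ _; apply: r.
by split=> *; apply: e; ring.
Qed.

Definition quot_ring : CommRing := QuotRing eq_mod_equiv eq_mod_ext eq_mod_th.

Definition quot_proj : A -> quot_ring := @class H A eq_mod.

Lemma quot_proj_hom : IsRingHom quot_proj.
Proof. by split=> // x y; [exact: classD|exact: classM]. Qed.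

Lemma quot_scal_hom : IsRingHom (fun r => quot_proj (scal A r)).
Proof.
case: (scal_hom A) quot_proj_hom => f1 fD fM [p1 pD pM].
by split=> [|x y|x y]; rewrite ?f1 ?fD ?fM.
Qed.

(** [A / (g_0, ..., g_(l-1))] *)
Definition QuotAlg : Algebra R :=
  {| alg := quot_ring; scal := fun r => quot_proj (scal A r);
     scal_hom := quot_scal_hom |}.
End QuotientAlgebra.

(** * Polynomial algebras

    [R[X_0, ..., X_(n-1)]] is the free commutative [R]-algebra on [n]
    generators: formal expressions modulo the laws of commutative
    [R]-algebras. *)

Inductive pexpr (R : CommRing) (n : nat) : Type :=
| PX (i : 'I_n)
| PC (r : R)
| Padd (a b : pexpr R n)
| Pmul (a b : pexpr R n)
| Popp (a : pexpr R n).

Arguments PX {R n}.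
Arguments PC {R} n.

Inductive peq (R : CommRing) (n : nat) : pexpr R n -> pexpr R n -> Prop :=
| peq_refl a : peq a a
| peq_sym a b : peq a b -> peq b a
| peq_trans a b c : peq a b -> peq b c -> peq a c
| peq_add a a' b b' : peq a a' -> peq b b' -> peq (Padd a b) (Padd a' b')
| peq_mul a a' b b' : peq a a' -> peq b b' -> peq (Pmul a b) (Pmul a' b')
| peq_opp a a' : peq a a' -> peq (Popp a) (Popp a')
| peq_add0 a : peq (Padd (PC n 0) a) a
| peq_addC a b : peq (Padd a b) (Padd b a)
| peq_addA a b c : peq (Padd a (Padd b c)) (Padd (Padd a b) c)
| peq_addN a : peq (Padd a (Popp a)) (PC n 0)
| peq_mul1 a : peq (Pmul (PC n 1) a) a
| peq_mulC a b : peq (Pmul a b) (Pmul b a)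
| peq_mulA a b c : peq (Pmul a (Pmul b c)) (Pmul (Pmul a b) c)
| peq_mulD a b c : peq (Pmul (Padd a b) c) (Padd (Pmul a c) (Pmul b c))
| peq_PCD r s : peq (PC n (r + s)) (Padd (PC n r) (PC n s))
| peq_PCM r s : peq (PC n (r * s)) (Pmul (PC n r) (PC n s)).

Section Polynomials.
Context {H : HoTT} (R : CommRing) (n : nat).

Lemma peq_equiv : Equivalence (@peq R n).
Proof. split; [exact: peq_refl|exact: peq_sym|exact: peq_trans]. Qed.

Lemma peq_ext : ring_eq_ext (@Padd R n) (@Pmul R n) (@Popp R n) (@peq R n).
Proof.
by split=> [a a' ? b b' ?|a a' ? b b' ?|a a' ?];
  [exact: peq_add|exact: peq_mul|exact: peq_opp].
Qed.

Lemma peq_th : ring_theory (PC n 0) (PC n 1) (@Padd R n) (@Pmul R n)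
  (fun a b => Padd a (Popp b)) (@Popp R n) (@peq R n).
Proof. by split=> *; constructor. Qed.

Definition poly_ring : CommRing := QuotRing peq_equiv peq_ext peq_th.

Definition pclass : pexpr R n -> poly_ring := @class H _ (@peq R n).

Lemma poly_scal_hom : IsRingHom (fun r => pclass (PC n r)).
Proof.
split=> // r s.
- by rewrite -[RHS]classD; apply: class_eq; [exact: peq_equiv|exact: peq_PCD].
- by rewrite -[RHS]classM; apply: class_eq; [exact: peq_equiv|exact: peq_PCM].
Qed.

Definition Poly : Algebra R :=
  {| alg := poly_ring; scal := fun r => pclass (PC n r); scal_hom := poly_scal_hom |}.

Definition PolyX (i : 'I_n) : Poly := pclass (PX i).

Add Ring poly_ring_ring : (cring_th poly_ring).

Fixpoint pderiv_expr (j : 'I_n) (a : pexpr R n) : poly_ring :=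
  match a with
  | PX i => if i == j then 1 else 0
  | PC r => 0
  | Padd a b => pderiv_expr j a + pderiv_expr j b
  | Pmul a b => pderiv_expr j a * pclass b + pclass a * pderiv_expr j b
  | Popp a => - pderiv_expr j a
  end.

Lemma pderiv_expr_eq j a b : peq a b -> pderiv_expr j a = pderiv_expr j b.
Proof.
have cE c d : peq c d -> pclass c = pclass d.
  by move=> cd; apply: class_eq => //; apply: peq_equiv.
have cD c d : pclass (Padd c d) = pclass c + pclass d := classD peq_equiv peq_ext peq_th c d.
have cM c d : pclass (Pmul c d) = pclass c * pclass d := classM peq_equiv peq_ext peq_th c d.
have cN c : pclass (Popp c) = - pclass c := classN peq_equiv peq_ext peq_th c.
have c1 : pclass (PC n 1) = 1 by [].
elim=> {a b}; cbn [pderiv_expr].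
- by [].
- by move=> a b _ ->.
- by move=> a b c _ -> _ ->.
- by move=> a a' b b' _ -> _ ->.
- by move=> a a' b b' /cE -> -> /cE -> ->.
- by move=> a a' _ ->.
- by move=> a; ring.
- by move=> a b; ring.
- by move=> a b c; ring.
- by move=> a; ring.
- by move=> a; rewrite c1; ring.
- by move=> a b; ring.
- by move=> a b c; rewrite !cM; ring.
- by move=> a b c; rewrite !cD; ring.
- by move=> r s; ring.
- by move=> r s; ring.
Qed.

(** The partial derivative [∂/∂X_j]. *)
Definition pderiv (j : 'I_n) : Poly -> Poly :=
  Quot_rec peq_equiv (@car_set poly_ring) (@pderiv_expr_eq j).
End Polynomials.

(** * Synthetic algebraic geometry over [R] *)

Section SyntheticGeometry.
Context {H : HoTT} (R : CommRing).

Definition IsFinitelyPresented (A : Algebra R) : Prop :=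
  merely {n : nat & {l : nat & {P : 'I_l -> Poly R n & AlgIso (QuotAlg P) A}}}.

Definition IsLocal : Type :=
  ((1 : R) <> 0) *
  (forall x y : R, IsUnit (x + y) -> merely (IsUnit x + IsUnit y)%type).

(** The map is an algebra homomorphism for the pointwise structure on the
    right-hand side by definition, so that it is an isomorphism of algebras as
    soon as it is an equivalence. *)
Definition Duality : Type :=
  forall A : Algebra R, IsFinitelyPresented A ->
    IsEquiv (fun (a : A) (x : Spec A) => value a x).

Definition ZariskiLocalChoice : Type :=
  forall A : Algebra R, IsFinitelyPresented A ->
  forall B : Spec A -> Type, (forall x, merely (B x)) ->
    merely {n : nat & {f : 'I_n -> A &
      (in_ideal f 1 *
       forall i, forall x : {x : Spec A & IsUnit (value (f i) x)}, B (projT1 x))%type}}.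

Definition IsOpenProp (P : hProp) : Prop :=
  merely {n : nat & {r : 'I_n -> R | P <-> merely {i : 'I_n | r i <> 0}}}.

Definition IsNilpotent (r : R) : Prop := merely {k : nat | power r k = 0}.

Definition IsClosedDense (P : hProp) : Prop :=
  merely {n : nat & {r : 'I_n -> R |
    (forall i, IsNilpotent (r i)) /\ (P <-> forall i, r i = 0)}}.

Definition IsFormallyEtale (X : Type) : Type :=
  forall P : hProp, IsClosedDense P -> IsEquiv (fun (x : X) (_ : P) => x).

Definition IsAffine (X : Type) : Prop :=
  merely {A : Algebra R & (IsFinitelyPresented A * Equiv X (Spec A))%type}.

Definition IsStandardEtale (X : Type) : Prop :=
  merely {n : nat & {P : 'I_n -> Poly R n &
    (IsUnit (det (fun i j => quot_proj P (pderiv j (P i)))) *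
     Equiv X (Spec (QuotAlg P)))%type}}.

Record FiniteOpenCover (C : Type -> Prop) (X : Type) := {
  cover_size : nat;
  piece : 'I_cover_size -> X -> hProp;
  piece_open : forall i x, IsOpenProp (piece i x);
  piece_cover : forall x, merely {i | piece i x};
  piece_in : forall i, C {x : X | piece i x}
}.

Definition IsScheme (X : Type) : Prop := merely (FiniteOpenCover IsAffine X).

Definition IsEtaleScheme (X : Type) : Type := (IsScheme X * IsFormallyEtale X)%type.
End SyntheticGeometry.

(* Main.v *)
From HB Require Import structures.
From Stdlib Require Import CRelationClasses Ring HLevels.
From mathcomp Require Import all_boot fingroup perm.
Require Import Defs.

(** An affine scheme is handled as the zero locus [zeros P] of finitely many
    polynomials in affine space, and duality is used in two forms: functions on
    a zero locus are polynomials ([duality_surj]), and polynomials vanishing on it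
    lie in the ideal ([duality_inj]).

    A scheme covered by standard étale schemes is étale. Lifting against a closed
    dense proposition reduces to lifting against [e = 0] with [e * e = 0]
    ([etale_of_square_zero]). On a standard étale scheme such a lift exists and is
    unique by one step of Newton's method, as the Jacobian matrix is invertible
    ([standard_lifts]). Étaleness then passes from the pieces to the scheme
    ([etale_cover]): a closed dense proposition is the spectrum of [R/(r)] with
    [r] nilpotent, which is local like [R], so Zariski-local choice on it is choice
    ([dense_choice]), and a map from it to the scheme lands in a single piece.

    Conversely, let [zeros P] be an affine piece of an étale scheme, with [n]
    variables and [l] equations. Moving a point along [e] of square zero shows that
    its tangent spaces vanish ([etale_tangent]), so the Jacobian matrix is
    injective and some minor of size [n] is invertible at each point, by McCoy's
    theorem ([injective_minor]). Fix the [n] equations of such a minor. The points of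
    [zeros P] where the minor is invertible form a closed subtype of the standard
    étale scheme [Y] defined by these [n] equations and the invertibility of the
    minor. Both are étale, so membership is an étale closed proposition, and such a
    proposition is decidable, because its ideal is equal to its own square
    ([etale_closed_decidable]). The characteristic function of the subtype is a
    function on [Y], and inverting it presents the subtype as a standard étale
    scheme ([etale_minor_standard]). The subtypes obtained from all choices of [n]
    equations, for all affine pieces, form the required cover; they are open
    because functions on [r <> 0] are fractions ([open_and_neq0]). *)

Set Implicit Arguments.
Unset Strict Implicit.
Unset Printing Implicit Defensive.

Local Open Scope cring_scope.

(** * Truncation, sets and bijections *)

Section Truncation.
Context {H : HoTT}.

Lemma hprop_forall (A : Type) (B : A -> Type) :
  (forall x, IsHProp (B x)) -> IsHProp (forall x, B x).
Proof. by move=> hB f g; apply: funext => x; apply: hB. Qed.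

Lemma hprop_sum (A B : Type) :
  IsHProp A -> IsHProp B -> (A -> B -> False) -> IsHProp (A + B)%type.
Proof.
move=> hA hB AB [a|b] [a'|b']; try by case: (AB _ _); eassumption.
- by rewrite (hA a a').
- by rewrite (hB b b').
Qed.

Lemma hprop_sig (A : Type) (P : A -> Prop) :
  (forall x, IsHProp (P x)) -> (forall x y, P x -> P y -> x = y) -> IsHProp {x | P x}.
Proof. by move=> hP uv u v; apply: sig_eq => //; apply: uv; [exact: (svalP u)|exact: (svalP v)]. Qed.

Lemma hset_sig (A : Type) (P : A -> Prop) :
  IsHSet A -> (forall x, IsHProp (P x)) -> IsHSet {x | P x}.
Proof.
move=> sA hP; apply: (@hset_of_rel _ (fun u v => sval u = sval v)) => //.
- by move=> u v; apply: sA.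
- by move=> u v; apply: sig_eq.
Qed.

Lemma hset_forall (A : Type) (B : A -> Type) :
  (forall x, IsHSet (B x)) -> IsHSet (forall x, B x).
Proof.
move=> sB; apply: (@hset_of_rel _ (fun f g => forall x, f x = g x)) => //.
- by move=> f g; apply: hprop_forall => x; apply: sB.
- by move=> f g; apply: funext.
Qed.

Lemma merely_bind (A B : Type) : merely A -> (A -> merely B) -> merely B.
Proof. by move=> mA f; move: mA; apply: merely_elim => //; apply: merely_hprop. Qed.

Lemma merely_map (A B : Type) (f : A -> B) : merely A -> merely B.
Proof. by move=> mA; apply: (merely_bind mA) => a; apply/merely_intro/f. Qed.

Lemma merely_false (A : Type) : merely A -> (A -> False) -> False.
Proof. by move=> mA f; move: mA; apply: merely_elim. Qed.

Lemma finite_choice (n : nat) (T : 'I_n -> Type) :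
  (forall i, merely (T i)) -> merely (forall i, T i).
Proof.
elim: n T => [|n IHn] T mT; first by apply: merely_intro => -[].
apply: (merely_bind (mT ord0)) => t0.
have := IHn (fun i => T (lift ord0 i)) (fun i => mT _).
apply: merely_map => t i; case: (unliftP ord0 i) => [j ->|->]; [exact: t|exact: t0].
Qed.

Definition Bij (A B : Type) : Type := {f : A -> B & {g : B -> A | cancel f g /\ cancel g f}}.

Lemma bij_sym A B : Bij A B -> Bij B A.
Proof. by case=> f [g [fK gK]]; exists g, f. Qed.

Lemma bij_trans A B C : Bij A B -> Bij B C -> Bij A C.
Proof.
case=> f [g [fK gK]] [f' [g' [fK' gK']]].
by exists (f' \o f), (g \o g'); split=> x /=; rewrite ?fK' ?fK ?gK ?gK'.
Qed.

Lemma bij_of_equiv A B : Equiv A B -> Bij A B.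
Proof.
case=> f e; exists f; exists (fun b => sval (sval (e b))); split => [a|b].
- by case: (e (f a)) => -[a' p] /= /(_ (exist _ a erefl)) [].
- by case: (e b) => -[].
Qed.

(** Without the adjunction law a two-sided inverse gives an equivalence only
    when the proofs that a point lies in a fiber are unique. *)
Lemma equiv_of_bij A B : IsHSet B -> Bij A B -> Equiv A B.
Proof.
move=> sB [f [g [fK gK]]]; exists f => b.
exists (exist _ (g b) (gK b)) => -[a p]; apply: sig_eq => [x|/=]; first exact: sB.
by rewrite -p fK.
Qed.

Lemma hset_bij A B : Bij A B -> IsHSet B -> IsHSet A.
Proof.
case=> f [g [fK _]] sB; apply: (@hset_of_rel _ (fun x y => f x = f y)) => //.
- by move=> x y; apply: sB.
- by move=> x y /(congr1 g); rewrite !fK.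
Qed.

Lemma bij_sig A B (P : A -> Prop) (Q : B -> Prop) (e : Bij A B) :
  (forall x, IsHProp (P x)) -> (forall y, IsHProp (Q y)) ->
  (forall x, P x <-> Q (projT1 e x)) -> Bij {x | P x} {y | Q y}.
Proof.
case: e => f [g [fK gK]] /= hP hQ PQ.
have PQ' y : Q y -> P (g y) by move=> q; apply/PQ; rewrite gK.
exists (fun u => exist _ (f (sval u)) ((PQ _).1 (svalP u))).
exists (fun v => exist _ (g (sval v)) (PQ' _ (svalP v))).
by split=> -[x p]; apply: sig_eq => //=.
Qed.

End Truncation.

(** * Commutative rings and determinants *)

Section MoreRingLaws.
Context (A : CommRing).
Add Ring A_ring : (cring_th A).

Lemma mul0l : left_zero zero (@mul A). Proof. move=> x; ring. Qed.
Lemma mul0r : right_zero zero (@mul A). Proof. move=> x; ring. Qed.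
Lemma mulDl : left_distributive (@mul A) (@add A). Proof. move=> x y z; ring. Qed.
Lemma mulDr : right_distributive (@mul A) (@add A). Proof. move=> x y z; ring. Qed.
Lemma addr0 (x : A) : x + 0 = x. Proof. ring. Qed.
Lemma mulr1 (x : A) : x * 1 = x. Proof. ring. Qed.
Lemma subr_eq0 (x y : A) : x - y = 0 -> x = y.
Proof. by move=> e; transitivity ((x - y) + y); [ring|rewrite e; ring]. Qed.
Lemma subrr (x : A) : x - x = 0. Proof. ring. Qed.
End MoreRingLaws.

HB.instance Definition _ (A : CommRing) :=
  Monoid.isMulLaw.Build A zero (@mul A) (@mul0l A) (@mul0r A).
HB.instance Definition _ (A : CommRing) :=
  Monoid.isAddLaw.Build A (@mul A) (@add A) (@mulDl A) (@mulDr A).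

Section Powers.
Context (A : CommRing).

Lemma powerD (x : A) j k : power x (j + k) = power x j * power x k.
Proof. by elim: j => [|j IHj]; [rewrite mul1|rewrite /= IHj mulA]. Qed.

Lemma power_square (x : A) k : power (x * x) k = power x (k + k).
Proof. by elim: k => [//|k IHk]; rewrite addnS /= IHk mulA. Qed.

End Powers.

Section Units.
Context {H : HoTT} (A : CommRing).
Add Ring A_ring : (cring_th A).

Lemma IsUnit_hprop (x : A) : IsHProp (IsUnit x).
Proof.
apply: hprop_sig => [y|y z xy xz]; first exact: car_set.
rewrite -[y]mul1 -xz (_ : x * z * y = (x * y) * z); last by ring.
by rewrite xy mul1.
Qed.

Lemma unit_factor (x y : A) : IsUnit (x * y) -> IsUnit x.
Proof. by case=> z xyz; exists (y * z); rewrite mulA. Qed.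

Lemma unit_mul (x y : A) : IsUnit x -> IsUnit y -> IsUnit (x * y).
Proof.
move=> [x' xx'] [y' yy']; exists (x' * y').
rewrite (_ : _ * _ = (x * x') * (y * y')); last by ring.
by rewrite xx' yy' mul1.
Qed.

Lemma unit_cancel (x y : A) : IsUnit x -> x * y = 0 -> y = 0.
Proof.
move=> [z xz] xy; rewrite -[y]mul1 -xz (_ : x * z * y = z * (x * y)); last by ring.
by rewrite xy mul0r.
Qed.

Lemma unit_power (x : A) k : IsUnit x -> IsUnit (power x k).
Proof.
move=> ux; rewrite /power; elim: k => [|k IHk] /=; first by exists 1; apply: mulr1.
exact: unit_mul.
Qed.

End Units.

Section Determinants.
Context (A : CommRing).
Add Ring A_ring : (cring_th A).

Definition sgn n (s : {perm 'I_n}) : A := if odd_perm s then opp 1 else 1.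

Definition kron n (i j : 'I_n) : A := if i == j then 1 else 0.

Lemma sum_kron n (i : 'I_n) (f : 'I_n -> A) : \big[add/0]_j (kron i j * f j) = f i.
Proof.
rewrite (bigD1 i) //= big1 => [|j /negPf ji]; rewrite /kron ?eqxx; first by ring.
by rewrite eq_sym ji; ring.
Qed.

Lemma eq_det n (M N : 'I_n -> 'I_n -> A) : (forall i j, M i j = N i j) -> det M = det N.
Proof.
by move=> MN; apply: eq_bigr => s _; congr (_ * _); apply: eq_bigr => i _.
Qed.

Lemma det_kron n : det (@kron n) = 1.
Proof.
rewrite /det (bigD1 1%g) //= odd_perm1 big1 => [|i _]; last by rewrite perm1 /kron eqxx.
rewrite big1 => [|s s1]; first by ring.
have [i si] : exists i, s i != i.
  apply/existsP; apply: contraT => /existsPn si; case/negP: s1; apply/eqP/permP => i.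
  by rewrite perm1; apply/eqP; move: (si i); rewrite negbK.
by rewrite (bigD1 i) //= /kron eq_sym (negPf si); ring.
Qed.

Lemma det_tr n (M : 'I_n -> 'I_n -> A) : det (fun i j => M j i) = det M.
Proof.
rewrite [LHS](reindex_inj invg_inj) /=.
apply: eq_bigr => s _ /=; rewrite !odd_permV (reindex_perm s) /=.
by congr (_ * _); apply: eq_bigr => i _; rewrite permK.
Qed.

(** Composition with the transposition of the two equal rows pairs even with odd
    permutations, and the terms of a pair cancel; this also covers
    characteristic 2. *)
Lemma det_alternate n (M : 'I_n -> 'I_n -> A) i1 i2 :
  i1 != i2 -> (forall j, M i1 j = M i2 j) -> det M = 0.
Proof.
move=> neq_i12 eqM; pose t := tperm i1 i2.
have oddMt s: odd_perm (t * s)%g = ~~ odd_perm s by rewrite odd_permM odd_tperm neq_i12.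
have negl (x : A) : opp 1 * x + 1 * x = 0 by ring.
rewrite [det M](bigID (@odd_perm _)) /= [X in X + _](reindex_inj (mulgI t)) /=.
rewrite (eq_bigl (fun s => ~~ odd_perm s)) => [|s]; last by rewrite oddMt.
rewrite -big_split big1 //= => s os; rewrite oddMt (negPf os) /=.
rewrite (_ : \big[mul/1]_i M i ((t * s)%g i) = \big[mul/1]_i M i (s i)); first exact: negl.
rewrite (reindex_perm t); apply: eq_bigr => /= i _.
by rewrite permM tpermK /t; case: tpermP => // ->; rewrite eqM.
Qed.

Definition set_row n (M : 'I_n -> 'I_n -> A) (k : 'I_n) (v : 'I_n -> A) :=
  fun i j => if i == k then v j else M i j.

Lemma det_set_row n (M : 'I_n -> 'I_n -> A) k v :
  det (set_row M k v) =
  \big[add/0]_(s : {perm 'I_n}) (v (s k) * (sgn s * \big[mul/1]_(i | i != k) M i (s i))).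
Proof.
apply: eq_bigr => s _; rewrite (bigD1 k) //= /set_row eqxx -/(sgn s).
rewrite (eq_bigr (fun i => M i (s i))) => [|i /negPf -> //]; ring.
Qed.

Lemma det_row_sum n (M : 'I_n -> 'I_n -> A) k m (a : 'I_m -> A) (v : 'I_m -> 'I_n -> A) :
  det (set_row M k (fun j => \big[add/0]_c (a c * v c j))) =
  \big[add/0]_c (a c * det (set_row M k (v c))).
Proof.
rewrite det_set_row; under [RHS]eq_bigr do rewrite det_set_row big_distrr /=.
rewrite exchange_big /=; apply: eq_bigr => s _; rewrite big_distrl /=.
by apply: eq_bigr => c _; ring.
Qed.

(** The entry [(c, k)] of the adjugate of [M], written as a determinant of the
    size of [M] so that Laplace expansion is linearity in the row [k]. *)
Definition cofactor n (M : 'I_n -> 'I_n -> A) (k c : 'I_n) : A := det (set_row M k (kron c)).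

Lemma expand_row n (M : 'I_n -> 'I_n -> A) k v :
  \big[add/0]_c (v c * cofactor M k c) = det (set_row M k v).
Proof.
rewrite -det_row_sum; apply: eq_det => i j; rewrite /set_row; case: eqP => // _.
rewrite -[RHS](sum_kron j v); apply: eq_bigr => c _; rewrite /kron eq_sym; ring.
Qed.

Lemma mul_adjugate n (M : 'I_n -> 'I_n -> A) i k :
  \big[add/0]_c (M i c * cofactor M k c) = if i == k then det M else 0.
Proof.
rewrite expand_row; case: eqP => [->|/eqP ik].
  by apply: eq_det => i' j; rewrite /set_row; case: eqP => // ->.
by apply: (det_alternate ik) => j; rewrite /set_row eqxx (negPf ik).
Qed.

(** The two descriptions of a cofactor, by replacing a row and by replacing a
    column, agree: in both only the permutations with [s k = c] contribute. *)
Lemma cofactor_tr n (M : 'I_n -> 'I_n -> A) k c :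
  cofactor (fun i j => M j i) c k = cofactor M k c.
Proof.
rewrite /cofactor !det_set_row [LHS](reindex_inj invg_inj) /=.
apply: eq_bigr => s _; rewrite /kron /sgn odd_permV -(inj_eq (@perm_inj _ s)) permKV.
rewrite [s k == c]eq_sym; case: eqP => [->|_]; last by ring.
congr (_ * (_ * _)); rewrite (reindex_perm s) /=; apply: eq_big => [i|i _].
  by rewrite (inj_eq (@perm_inj _ s)).
by rewrite permK.
Qed.

Lemma adjugate_mul n (M : 'I_n -> 'I_n -> A) c c' :
  \big[add/0]_k (cofactor M k c * M k c') = if c' == c then det M else 0.
Proof.
rewrite -det_tr -(mul_adjugate (fun i j => M j i)).
by apply: eq_bigr => k _; rewrite cofactor_tr mulC.
Qed.

Lemma det_mul_kernel n (M : 'I_n -> 'I_n -> A) (h : 'I_n -> A) :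
  (forall i, \big[add/0]_j (M i j * h j) = 0) -> forall c, det M * h c = 0.
Proof.
move=> Mh c.
transitivity (\big[add/0]_k (cofactor M k c * \big[add/0]_j (M k j * h j))); last first.
  by apply: big1 => k _; rewrite Mh; ring.
under eq_bigr do rewrite big_distrr /=.
rewrite exchange_big /= (bigD1 c) //= [X in _ + X]big1 => [|j /negPf jc].
  under [in RHS]eq_bigr do rewrite mulA.
  by rewrite addr0 -big_distrl /= adjugate_mul eqxx.
under eq_bigr do rewrite mulA.
by rewrite -big_distrl /= adjugate_mul jc; ring.
Qed.

Lemma unit_det_solve n (M : 'I_n -> 'I_n -> A) (b : 'I_n -> A) :
  IsUnit (det M) -> {h : 'I_n -> A | forall i, \big[add/0]_j (M i j * h j) = b i}.
Proof.
case=> d detd; exists (fun j => \big[add/0]_k (d * b k * cofactor M k j)) => i.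
under eq_bigr do rewrite big_distrr /=.
rewrite exchange_big /= (bigD1 i) //= [X in _ + X]big1 => [|k /negPf ki].
  rewrite (eq_bigr (fun c => d * b i * (M i c * cofactor M i c))) => [|c _]; last by ring.
  rewrite -big_distrr /= mul_adjugate eqxx.
  rewrite (_ : _ + 0 = det M * d * b i); last by ring.
  by rewrite detd mul1.
rewrite (eq_bigr (fun c => d * b k * (M i c * cofactor M k c))) => [|c _]; last by ring.
by rewrite -big_distrr /= mul_adjugate eq_sym ki; ring.
Qed.

Lemma det_last_col n (M : 'I_n.+1 -> 'I_n.+1 -> A) :
  (forall i, M (lift ord_max i) ord_max = 0) ->
  det M = det (fun i j => M (lift ord_max i) (lift ord_max j)) * M ord_max ord_max.
Proof.
move=> M0.
have liftE i : widen_ord (leqnSn n) i = lift ord_max i.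
  by apply: val_inj; rewrite /= /bump leqNgt ltn_ord.
rewrite /det (bigID (fun s : {perm 'I_n.+1} => s ord_max == ord_max)) /=.
rewrite [X in _ + X]big1 => [|s smax]; last first.
  have [|i def] := @unlift_some _ ord_max ((s^-1)%g ord_max).
    by apply: contra smax => /eqP {1}->; rewrite permKV.
  move=> _; rewrite (bigD1 (lift ord_max i)) //= -def permKV {1}def M0; ring.
(* The permutations fixing the last index are those of the other indices. *)
rewrite addr0 (reindex (lift_perm ord_max ord_max)) /=; last first.
  pose ulsf i (s : {perm 'I_n.+1}) k := odflt k (unlift (s i) (s (lift i k))).
  have ulsfK i (s : {perm 'I_n.+1}) k : lift (s i) (ulsf i s k) = s (lift i k).
    rewrite /ulsf; have := neq_lift i k.
    by rewrite -(can_eq (permK s)) => /unlift_some[] ? ? ->.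
  have inj_ulsf s : injective (ulsf ord_max s).
    apply: can_inj (ulsf (s ord_max) s^-1%g) _ => k'.
    by rewrite {1}/ulsf ulsfK !permK liftK.
  exists (fun s => perm (inj_ulsf s)) => [s _ | s].
    by apply/permP=> k'; rewrite permE /ulsf lift_perm_lift lift_perm_id liftK.
  move/(s _ =P _) => si0; apply/permP=> k.
  case: (unliftP ord_max k) => [k'|] ->; rewrite ?lift_perm_id //.
  by rewrite lift_perm_lift permE -ulsfK si0.
rewrite big_distrl /=; apply: eq_big => [s|s _]; first by rewrite lift_perm_id eqxx.
rewrite big_ord_recr /= lift_perm_id -mulA; congr (_ * (_ * _)).
  by rewrite odd_lift_perm addbb.
by apply: eq_bigr => i _; rewrite liftE lift_perm_lift.
Qed.

End Determinants.

(** * Evaluation of polynomials *)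

Section Homs.
Context (A B : CommRing) (f : A -> B) (fh : IsRingHom f).
Add Ring A_ring : (cring_th A).
Add Ring B_ring : (cring_th B).

Lemma hom_zero : f 0 = 0.
Proof.
have e : f 0 = f 0 + f 0 by rewrite -(hom_add fh) add0.
transitivity ((f 0 + f 0) - f 0); first by ring.
by rewrite -e; ring.
Qed.

Lemma hom_opp x : f (- x) = - f x.
Proof.
have e : f (- x) + f x = 0 by rewrite -(hom_add fh) -hom_zero; congr f; ring.
transitivity ((f (- x) + f x) - f x); first by ring.
by rewrite e; ring.
Qed.

Lemma hom_sub x y : f (x - y) = f x - f y.
Proof.
rewrite (_ : x - y = x + - y); last by ring.
by rewrite (hom_add fh) hom_opp; ring.
Qed.

Lemma hom_sum I (s : seq I) (P : pred I) (F : I -> A) :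
  f (\big[add/0]_(i <- s | P i) F i) = \big[add/0]_(i <- s | P i) f (F i).
Proof. exact: (big_morph f (hom_add fh) hom_zero). Qed.

Lemma hom_det n (M : 'I_n -> 'I_n -> A) : f (det M) = det (fun i j => f (M i j)).
Proof.
rewrite hom_sum; apply: eq_bigr => s _; rewrite (hom_mul fh); congr (_ * _).
  by case: ifP; rewrite ?hom_opp (hom_one fh).
exact: (big_morph f (hom_mul fh) (hom_one fh)).
Qed.

Lemma hom_unit x : IsUnit x -> IsUnit (f x).
Proof. by case=> y xy; exists (f y); rewrite -(hom_mul fh) xy (hom_one fh). Qed.

End Homs.

Section Polynomials.
Context {H : HoTT} (R : CommRing).
Add Ring R_ring : (cring_th R).

Section Laws.
Context (n : nat).
Implicit Types (p q : Poly R n) (i j : 'I_n).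

Lemma poly_ind (T : Poly R n -> Type) :
  (forall p, IsHProp (T p)) ->
  (forall i, T (PolyX R i)) -> (forall r, T (scal (Poly R n) r)) ->
  (forall p q, T p -> T q -> T (p + q)) -> (forall p q, T p -> T q -> T (p * q)) ->
  (forall p, T p -> T (- p)) -> forall p, T p.
Proof.
move=> hT TX TC TD TM TN; apply: Quot_ind => // a.
rewrite -/(pclass a); elim: a => [i|r|a Ta b Tb|a Ta b Tb|a Ta].
- exact: TX.
- exact: TC.
- by rewrite /pclass (classD (peq_equiv R n) (peq_ext R n) (peq_th R n)); apply: TD.
- by rewrite /pclass (classM (peq_equiv R n) (peq_ext R n) (peq_th R n)); apply: TM.
- by rewrite /pclass (classN (peq_equiv R n) (peq_ext R n) (peq_th R n)); apply: TN.
Qed.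

Lemma poly_eq (B : Type) (f g : Poly R n -> B) : IsHSet B ->
  (forall i, f (PolyX R i) = g (PolyX R i)) ->
  (forall r, f (scal (Poly R n) r) = g (scal (Poly R n) r)) ->
  (forall p q, f p = g p -> f q = g q -> f (p + q) = g (p + q)) ->
  (forall p q, f p = g p -> f q = g q -> f (p * q) = g (p * q)) ->
  (forall p, f p = g p -> f (- p) = g (- p)) -> forall p, f p = g p.
Proof. by move=> sB *; apply: (poly_ind (T := fun p => f p = g p)) => // q; apply: sB. Qed.

Lemma pderiv_class j (a : pexpr R n) : pderiv j (pclass a) = pderiv_expr j a.
Proof. exact: Quot_recE. Qed.

Lemma pderivX (j i : 'I_n) : pderiv j (PolyX R i) = if i == j then 1 else 0.
Proof. exact: pderiv_class. Qed.

Lemma pderiv_scal (j : 'I_n) r : pderiv j (scal (Poly R n) r) = 0.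
Proof. exact: pderiv_class. Qed.

Lemma pderivD j p q : pderiv j (p + q) = pderiv j p + pderiv j q.
Proof.
move: p q; apply: Quot_ind => [p|a]; first by apply: hprop_forall => q; apply: car_set.
apply: Quot_ind => [q|b]; first exact: car_set.
by rewrite -/(pclass a) -/(pclass b) -[X in pderiv j X]classD 3!pderiv_class.
Qed.

Lemma pderivM j p q : pderiv j (p * q) = pderiv j p * q + p * pderiv j q.
Proof.
move: p q; apply: Quot_ind => [p|a]; first by apply: hprop_forall => q; apply: car_set.
apply: Quot_ind => [q|b]; first exact: car_set.
by rewrite -/(pclass a) -/(pclass b) -[X in pderiv j X]classM 3!pderiv_class.
Qed.

Lemma pderivN j p : pderiv j (- p) = - pderiv j p.
Proof.
move: p; apply: Quot_ind => [p|a]; first exact: car_set.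
by rewrite -/(pclass a) -[X in pderiv j X]classN 2!pderiv_class.
Qed.

End Laws.

Section Substitution.
Context (n : nat) (B : Algebra R) (x : 'I_n -> B).
Add Ring B_ring : (cring_th B).

Fixpoint subst_expr (a : pexpr R n) : B :=
  match a with
  | PX i => x i
  | PC r => scal B r
  | Padd a b => subst_expr a + subst_expr b
  | Pmul a b => subst_expr a * subst_expr b
  | Popp a => - subst_expr a
  end.

Lemma subst_expr_eq a b : peq a b -> subst_expr a = subst_expr b.
Proof.
have sh := scal_hom B.
elim=> {a b} /=; rewrite ?(hom_zero sh) ?(hom_one sh); try by move=> *; ring.
- by move=> a b _ ->.
- by move=> a b c _ -> _ ->.
- by move=> a a' b b' _ -> _ ->.
- by move=> a a' b b' _ -> _ ->.
- by move=> a a' _ ->.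
- by move=> r s; rewrite (hom_add sh).
- by move=> r s; rewrite (hom_mul sh).
Qed.

Definition subst : Poly R n -> B := Quot_rec (peq_equiv R n) (@car_set B) subst_expr_eq.

Lemma subst_class a : subst (pclass a) = subst_expr a.
Proof. exact: Quot_recE. Qed.

Lemma substX i : subst (PolyX R i) = x i.
Proof. exact: subst_class. Qed.

Lemma subst_scal r : subst (scal (Poly R n) r) = scal B r.
Proof. exact: subst_class. Qed.

Lemma subst_hom : IsRingHom subst.
Proof.
split; first by rewrite -(hom_one (scal_hom B)) -subst_scal.
- apply: Quot_ind => [p|a]; first by apply: hprop_forall => q; apply: car_set.
  apply: Quot_ind => [q|b]; first exact: car_set.
  by rewrite -/(pclass a) -/(pclass b) -[X in subst X]classD 3!subst_class.
- apply: Quot_ind => [p|a]; first by apply: hprop_forall => q; apply: car_set.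
  apply: Quot_ind => [q|b]; first exact: car_set.
  by rewrite -/(pclass a) -/(pclass b) -[X in subst X]classM 3!subst_class.
Qed.

Lemma subst_unique (f : Poly R n -> B) : IsRingHom f ->
  (forall r, f (scal (Poly R n) r) = scal B r) -> (forall i, f (PolyX R i) = x i) ->
  forall p, f p = subst p.
Proof.
move=> fh fC fX; apply: poly_eq => [|i|r|p q|p q|p]; first exact: car_set.
- by rewrite fX substX.
- by rewrite fC subst_scal.
- by rewrite (hom_add fh) (hom_add subst_hom) => -> ->.
- by rewrite (hom_mul fh) (hom_mul subst_hom) => -> ->.
- by rewrite (hom_opp fh) (hom_opp subst_hom) => ->.
Qed.

End Substitution.

Definition eval n (x : 'I_n -> R) (p : Poly R n) : R := subst (B := regular R) x p.

Lemma eval_hom n (x : 'I_n -> R) : IsRingHom (eval x).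
Proof. exact: (subst_hom (B := regular R)). Qed.

Lemma evalX n (x : 'I_n -> R) i : eval x (PolyX R i) = x i.
Proof. exact: (substX (B := regular R)). Qed.

Lemma eval_scal n (x : 'I_n -> R) r : eval x (scal (Poly R n) r) = r.
Proof. exact: (subst_scal (B := regular R)). Qed.

Lemma evalD n (x : 'I_n -> R) p q : eval x (p + q) = eval x p + eval x q.
Proof. exact: (hom_add (eval_hom x)). Qed.

Lemma evalM n (x : 'I_n -> R) p q : eval x (p * q) = eval x p * eval x q.
Proof. exact: (hom_mul (eval_hom x)). Qed.

Lemma evalN n (x : 'I_n -> R) p : eval x (- p) = - eval x p.
Proof. exact: (hom_opp (eval_hom x)). Qed.

Lemma evalB n (x : 'I_n -> R) p q : eval x (p - q) = eval x p - eval x q.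
Proof. exact: (hom_sub (eval_hom x)). Qed.

Lemma eval0 n (x : 'I_n -> R) : eval x 0 = 0.
Proof. exact: (hom_zero (eval_hom x)). Qed.

Lemma eval1 n (x : 'I_n -> R) : eval x 1 = 1.
Proof. exact: (hom_one (eval_hom x)). Qed.

Lemma eval_taylor n (x h : 'I_n -> R) (e : R) (p : Poly R n) : e * e = 0 ->
  eval (fun i => x i + e * h i) p =
  eval x p + e * \big[add/0]_j (eval x (pderiv j p) * h j).
Proof.
move=> ee; move: p; apply: poly_eq => [|i|r|p q ep eq|p q ep eq|p ep]; first exact: car_set.
- rewrite !evalX -[in LHS](sum_kron i h); congr (_ + _ * _); apply: eq_bigr => j _.
  by rewrite pderivX /kron; case: eqP; rewrite ?eval1 ?eval0.
- rewrite !eval_scal big1 => [|j _]; first by ring.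
  by rewrite pderiv_scal eval0; ring.
- rewrite !evalD ep eq; under [in RHS]eq_bigr do rewrite pderivD evalD mulDl.
  by rewrite big_split /=; ring.
- rewrite !evalM ep eq.
  rewrite [in RHS](eq_bigr (fun j => eval x q * (eval x (pderiv j p) * h j) +
    eval x p * (eval x (pderiv j q) * h j))) => [|j _]; last first.
    by rewrite pderivM evalD !evalM; ring.
  rewrite big_split /= -!big_distrr /=.
  set a := eval x p; set b := eval x q; set a' := \big[_/_]_i _; set b' := \big[_/_]_i _.
  rewrite (_ : (a + _) * _ = a * b + e * (b * a' + a * b') + e * e * (a' * b')); last by ring.
  by rewrite ee; ring.
- rewrite !evalN ep.
  rewrite [in RHS](eq_bigr (fun j => opp 1 * (eval x (pderiv j p) * h j))) => [|j _].
    by rewrite -big_distrr /=; ring.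
  by rewrite pderivN evalN; ring.
Qed.

Definition jac n l (P : 'I_l -> Poly R n) (x : 'I_n -> R) (i : 'I_l) (j : 'I_n) : R :=
  eval x (pderiv j (P i)).

End Polynomials.

(** * Zero loci and duality *)

Section ZeroLoci.
Context {H : HoTT} (R : CommRing).
Add Ring R_ring : (cring_th R).

Definition zeros n l (P : 'I_l -> Poly R n) : Type :=
  {x : 'I_n -> R | forall j, eval x (P j) = 0}.

Lemma hset_zeros n l (P : 'I_l -> Poly R n) : IsHSet (zeros P).
Proof.
apply: hset_sig => [|x]; first by apply: hset_forall => i; apply: car_set.
by apply: hprop_forall => j; apply: car_set.
Qed.

Lemma hprop_spec (A : Algebra R) (f : A -> regular R) :
  IsHProp (IsRingHom f /\ forall r, f (scal A r) = scal (regular R) r).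
Proof.
have hp1 (B : Type) (g h : B -> R) : IsHProp (forall r, g r = h r).
  by apply: hprop_forall => r; apply: car_set.
have hp2 (B : Type) (g h : B -> B -> R) : IsHProp (forall r s, g r s = h r s).
  by apply: hprop_forall => r; apply: hp1.
move=> [[f1 fD fM] fC] [[f1' fD' fM'] fC'].
by rewrite (car_set f1 f1') (hp2 _ _ _ fD fD') (hp2 _ _ _ fM fM') (hp1 _ _ _ fC fC').
Qed.

Lemma hset_spec (A : Algebra R) : IsHSet (Spec A).
Proof.
by apply: hset_sig => [|f]; [apply: hset_forall => a; apply: car_set|apply: hprop_spec].
Qed.

Section Spec.
Context (n l : nat) (P : 'I_l -> Poly R n).
Add Ring Poly_ring : (cring_th (Poly R n)).

Lemma quot_proj_eq0 (p : Poly R n) : quot_proj P p = 0 -> in_ideal P p.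
Proof.
move/(class_eff (eq_mod_equiv P)).
apply: merely_elim; first exact: merely_hprop.
by rewrite /eq_mod (_ : p - 0 = p) //; ring.
Qed.

Lemma eval_ideal (z : zeros P) p : in_ideal P p -> eval (sval z) p = 0.
Proof.
apply: merely_elim => [|[c ->]]; first exact: car_set.
rewrite (hom_sum (eval_hom _)) big1 // => i _.
by rewrite evalM (svalP z); ring.
Qed.

Lemma eval_eq_mod (z : zeros P) p q : eq_mod P p q -> eval (sval z) p = eval (sval z) q.
Proof. by move/(eval_ideal z); rewrite evalB; apply: subr_eq0. Qed.

Definition zero_hom (z : zeros P) : QuotAlg P -> R :=
  Quot_rec (eq_mod_equiv P) (@car_set R) (@eval_eq_mod z).

Lemma zero_homE z p : zero_hom z (quot_proj P p) = eval (sval z) p.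
Proof. exact: Quot_recE. Qed.

Lemma quot_hom (f : Spec (QuotAlg P)) : IsRingHom (fun p => value (A := QuotAlg P) (quot_proj P p) f).
Proof.
case: f => f [[f1 fD fM] fC]; have [p1 pD pM] := quot_proj_hom P.
by split => [|p q|p q]; rewrite /value /= ?p1 ?pD ?pM ?f1 ?fD ?fM.
Qed.

Lemma zero_hom_spec z : IsRingHom (B := regular R) (zero_hom z) /\
  forall r, zero_hom z (scal (QuotAlg P) r) = scal (regular R) r.
Proof.
have [p1 pD pM] := quot_proj_hom P.
split=> [|r]; last by rewrite [LHS]zero_homE eval_scal.
split; first by rewrite -p1 zero_homE eval1.
- apply: Quot_ind => [p|p]; first by apply: hprop_forall => q; apply: car_set.
  apply: Quot_ind => [q|q]; first exact: car_set.
  by rewrite -/(quot_proj P p) -/(quot_proj P q) -pD !zero_homE evalD.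
- apply: Quot_ind => [p|p]; first by apply: hprop_forall => q; apply: car_set.
  apply: Quot_ind => [q|q]; first exact: car_set.
  by rewrite -/(quot_proj P p) -/(quot_proj P q) -pM !zero_homE evalM.
Qed.

Definition spec_of_zero (z : zeros P) : Spec (QuotAlg P) := exist _ _ (zero_hom_spec z).

Definition spec_coord (f : Spec (QuotAlg P)) (i : 'I_n) : R :=
  value (A := QuotAlg P) (quot_proj P (PolyX R i)) f.

Lemma value_quot_proj f p : value (A := QuotAlg P) (quot_proj P p) f = eval (spec_coord f) p.
Proof.
apply: (subst_unique (B := regular R) (f := fun p => value (A := QuotAlg P) (quot_proj P p) f)) => //.
- exact: quot_hom.
- by case: f => f [fh fC] r; apply: fC.
Qed.

Lemma spec_coord_zero f j : eval (spec_coord f) (P j) = 0.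
Proof.
rewrite -value_quot_proj (_ : quot_proj P (P j) = 0).
  by rewrite /value (hom_zero (svalP f).1).
apply: (class_eq (eq_mod_equiv P)); apply: merely_intro.
by exists (kron _ j); rewrite sum_kron; ring.
Qed.

Definition zero_of_spec f : zeros P := exist _ (spec_coord f) (spec_coord_zero f).

Lemma spec_of_zeroK : cancel spec_of_zero zero_of_spec.
Proof.
move=> z; apply: sig_eq => [x|]; first by apply: hprop_forall => j; apply: car_set.
by apply: funext => i; rewrite /= /spec_coord /value /= zero_homE evalX.
Qed.

Lemma zero_of_specK : cancel zero_of_spec spec_of_zero.
Proof.
move=> f; apply: sig_eq => [g|]; first exact: hprop_spec.
apply: funext; apply: Quot_ind => [u|p]; first exact: car_set.
by rewrite -/(quot_proj P p) [LHS]zero_homE -value_quot_proj.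
Qed.

Lemma spec_bij : Bij (Spec (QuotAlg P)) (zeros P).
Proof.
exists zero_of_spec, spec_of_zero.
by split; [exact: zero_of_specK|exact: spec_of_zeroK].
Qed.

Lemma quot_presented : IsFinitelyPresented (QuotAlg P).
Proof.
apply: merely_intro; exists n, l, P.
exists (exist _ (fun a => a) (conj (id_hom (QuotAlg P)) (fun=> erefl))) => b.
by exists (exist (fun a => a = b) b erefl) => -[a ab]; apply: sig_eq => [x|] //; apply: car_set.
Qed.

End Spec.

Lemma spec_precomp (A B : Algebra R) (f : A -> B) (fh : IsRingHom f)
    (fC : forall r, f (scal A r) = scal B r) (x : Spec B) :
  IsRingHom (B := regular R) (sval x \o f) /\
  forall r, sval x (f (scal A r)) = scal (regular R) r.
Proof.
case: x => x [[x1 xD xM] xC]; case: fh => [f1 fD fM] /=.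
by split=> [|r]; [split=> [|a b|a b] /=|]; rewrite ?f1 ?fD ?fM ?fC.
Qed.

Lemma spec_iso (A B : Algebra R) : AlgIso A B -> Bij (Spec B) (Spec A).
Proof.
move=> [[f [fh fC]] fe].
have [g [fK gK]] : {g | cancel f g /\ cancel g f}.
  exists (fun b => sval (sval (fe b))); split => [a|b].
    by case: (fe (f a)) => -[a' p] /= /(_ (exist (fun a'' => f a'' = f a) a erefl)) [].
  by case: (fe b) => -[].
have gh : IsRingHom g.
  by have [f1 fD fM] := fh; split => [|x y|x y]; apply: (can_inj fK); rewrite gK ?fD ?fM ?gK.
have gC r : g (scal B r) = scal A r by apply: (can_inj fK); rewrite gK fC.
exists (fun x => exist _ _ (spec_precomp fh fC x) : Spec A).
exists (fun x => exist _ _ (spec_precomp gh gC x) : Spec B).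
by split=> x; apply: sig_eq; try exact: hprop_spec; apply: funext => a /=; rewrite ?fK ?gK.
Qed.

Lemma affine_zeros X : IsAffine R X ->
  merely {n : nat & {l : nat & {P : 'I_l -> Poly R n & Bij X (zeros P)}}}.
Proof.
move=> aff; apply: (merely_bind aff) => -[A [pA /bij_of_equiv XA]].
apply: merely_map pA => -[n [l [P e]]]; exists n, l, P.
exact: bij_trans XA (bij_trans (spec_iso e) (spec_bij P)).
Qed.

Section DualityConsequences.
Context (duality : Duality R).

(** This lemma and [duality_inj] are the two halves of duality, stated for
    points of affine space instead of algebra homomorphisms; everything below
    uses duality in this form. *)
Lemma duality_surj n l (P : 'I_l -> Poly R n) (f : zeros P -> R) :
  merely {p : Poly R n | forall z, f z = eval (sval z) p}.
Proof.
have [[a ae] _] := duality (quot_presented P) (fun x => f (zero_of_spec x)).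
move: a ae; apply: Quot_ind => [a|p pe].
  by apply: hprop_forall => ?; apply: merely_hprop.
apply: merely_intro; exists p => z.
have := congr1 (fun g => g (spec_of_zero z)) pe.
by rewrite /= spec_of_zeroK => <-; rewrite /value /= [LHS]zero_homE.
Qed.

Lemma duality_inj n l (P : 'I_l -> Poly R n) (p : Poly R n) :
  (forall z : zeros P, eval (sval z) p = 0) -> in_ideal P p.
Proof.
move=> p0; apply: quot_proj_eq0.
have [[a ae] ac] := duality (quot_presented P) (fun=> 0).
have h0 : (fun x => value (A := QuotAlg P) 0 x) = (fun=> 0).
  by apply: funext => x; rewrite /value (hom_zero (svalP x).1).
have hp : (fun x => value (A := QuotAlg P) (quot_proj P p) x) = (fun=> 0).
  by apply: funext => x; rewrite value_quot_proj (p0 (zero_of_spec x)).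
have e1 := congr1 sval (ac (exist _ _ h0)).
by have := congr1 sval (ac (exist _ _ hp)); rewrite e1.
Qed.

End DualityConsequences.
End ZeroLoci.

(** * Open, closed and closed dense propositions *)

Section Propositions.
Context {H : HoTT} (R : CommRing).
Add Ring R_ring : (cring_th R).
Context (local : IsLocal R) (duality : Duality R).

Lemma unit_neq0 (r : R) : IsUnit r -> r <> 0.
Proof. by case=> s rs r0; case: local => /(_ _) [] //; rewrite -rs r0 mul0l. Qed.

Lemma nilpotent_not_unit (r : R) : IsNilpotent r -> IsUnit r -> False.
Proof.
by move=> nr ur; apply: (merely_false nr) => -[k]; apply/unit_neq0/unit_power.
Qed.

Lemma unit_sum I (s : seq I) (f : I -> R) :
  IsUnit (\big[add/0]_(i <- s) f i) -> merely {i & IsUnit (f i)}.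
Proof.
elim: s => [|i s IHs]; first by rewrite big_nil => /unit_neq0.
rewrite big_cons => /local.2 m; apply: (merely_bind m) => -[u|/IHs //].
by apply: merely_intro; exists i.
Qed.

Definition const_poly m (r : 'I_m -> R) (j : 'I_m) : Poly R 0 := scal (Poly R 0) (r j).

Section Closed.
Context (m : nat) (r : 'I_m -> R).

Local Notation P := (const_poly r).

Lemma closed_zero (z : zeros P) : forall j, r j = 0.
Proof. by move=> j; rewrite -(svalP z j) eval_scal. Qed.

Lemma zero_closed (x : 'I_0 -> R) : (forall j, r j = 0) -> forall j, eval x (P j) = 0.
Proof. by move=> r0 j; rewrite eval_scal. Qed.

Lemma closed_hprop : IsHProp (forall j, r j = 0).
Proof. by apply: hprop_forall => j; apply: car_set. Qed.

(** The proposition [forall j, r j = 0] is the spectrum of [R/(r)], presented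
    without variables: a function on it is an element of [R/(r)], and any
    representative in [R] is a constant extending the function. *)
Lemma closed_extend (f : (forall j, r j = 0) -> R) : merely {a : R | forall q, f q = a}.
Proof.
have := duality_surj duality (fun z => f (closed_zero z)).
apply: merely_map => -[p fp]; pose x : 'I_0 -> R := fun=> 0.
exists (eval x p) => q; rewrite -(fp (exist _ x (zero_closed x q))).
by congr f; apply: closed_hprop.
Qed.

Lemma closed_ideal (a : R) : ((forall j, r j = 0) -> a = 0) ->
  merely {c : 'I_m -> R | a = \big[add/0]_j (c j * r j)}.
Proof.
move=> a0.
have p0 (z : zeros P) : eval (sval z) (scal (Poly R 0) a) = 0.
  by rewrite eval_scal; apply/a0/closed_zero.
have := duality_inj duality p0; rewrite /in_ideal; apply: merely_map => -[c ac].
pose x : 'I_0 -> R := fun=> 0; exists (fun j => eval x (c j)).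
rewrite -[LHS](eval_scal x) ac (hom_sum (eval_hom x)).
by apply: eq_bigr => j _; rewrite evalM eval_scal.
Qed.

(** If the spectrum of [R/(r)] is empty, then [1] lies in the ideal of the [r j];
    by locality one of the summands of [1] is invertible. *)
Lemma not_all_zero : ~ (forall j, r j = 0) -> merely {j & IsUnit (r j)}.
Proof.
move=> nr; have r1 : (forall j, r j = 0) -> (1 : R) = 0 by move/nr.
apply: (merely_bind (closed_ideal r1)) => -[c c1].
have : IsUnit (\big[add/0]_j (c j * r j)) by rewrite -c1; exists 1; apply: mul1.
move/unit_sum; apply: merely_map => -[j]; rewrite mulC => /unit_factor u.
by exists j.
Qed.

End Closed.

Lemma neq0_unit (r : R) : r <> 0 -> IsUnit r.
Proof.
move=> r0; have : ~ forall j : 'I_1, (fun=> r) j = 0 by move/(_ ord0).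
by move/not_all_zero; apply: merely_elim => [|[]] //; apply: IsUnit_hprop.
Qed.

Lemma closed_ideal_fin (I : finType) (r : I -> R) (a : R) :
  ((forall i, r i = 0) -> a = 0) -> merely {c : I -> R | a = \big[add/0]_i (c i * r i)}.
Proof.
move=> a0; have a0' : (forall k : 'I_#|I|, r (enum_val k) = 0) -> a = 0.
  by move=> r0; apply: a0 => i; rewrite -(enum_rankK i).
have := closed_ideal a0'; apply: merely_map => -[c ac]; exists (fun i => c (enum_rank i)).
rewrite ac [RHS](reindex _ (onW_bij _ (@enum_val_bij I))).
by apply: eq_bigr => k _; rewrite enum_valK.
Qed.

Lemma not_all_zero_fin (I : finType) (r : I -> R) :
  ~ (forall i, r i = 0) -> merely {i & IsUnit (r i)}.
Proof.
move=> nr; have nr' : ~ forall k : 'I_#|I|, r (enum_val k) = 0.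
  by move=> r0; apply: nr => i; rewrite -(enum_rankK i).
by have := not_all_zero nr'; apply: merely_map => -[k u]; exists (enum_val k).
Qed.

(** An open proposition is the negation of a closed one, by [not_all_zero]. *)
Lemma open_stable (U : hProp) : IsOpenProp R U -> ~ ~ U -> U.
Proof.
move=> oU nnU; apply: (merely_elim _ _ oU); first exact: holds_hprop.
move=> [n [r Ur]]; apply/Ur.
have nr : ~ forall i, r i = 0.
  by move=> r0; apply: nnU => /Ur /merely_false; apply=> -[i]; apply; apply: r0.
apply: merely_map (not_all_zero nr) => -[i /unit_neq0 ri]; by exists i.
Qed.

Section Dense.
Context (Q : hProp) (dQ : IsClosedDense R Q).

(** If a closed proposition fails, one of its equations has an invertible left
    side, which is not nilpotent. *)
Lemma dense_not_not : ~ ~ Q.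
Proof.
move=> nQ; apply: (merely_false dQ) => -[m [r [nil Qr]]].
have nr : ~ forall j, r j = 0 by move/Qr.
by apply: (merely_false (not_all_zero nr)) => -[j]; apply: nilpotent_not_unit.
Qed.

Lemma open_dense (U : hProp) : IsOpenProp R U -> (Q -> U) -> U.
Proof. by move=> oU QU; apply: open_stable => // nU; apply: dense_not_not => /QU. Qed.

Lemma unit_dense (r : R) : (Q -> IsUnit r) -> IsUnit r.
Proof.
by move=> Qr; apply: neq0_unit => r0; apply: dense_not_not => /Qr /unit_neq0.
Qed.

Lemma dense_extend (f : Q -> R) : merely {a : R | forall q, f q = a}.
Proof.
apply: (merely_bind dQ) => -[m [r [_ Qr]]].
apply: merely_map (closed_extend (fun q => f (Qr.2 q))) => -[a fa]; exists a => q.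
by rewrite -(fa (Qr.1 q)); congr f; apply: holds_hprop.
Qed.

(** The truth values of [j q = i] extend to elements [a i] of [R]; they cannot
    all vanish, since [Q] is not false, and where [a i] is invertible [j] is
    constantly [i]. *)
Lemma dense_const k (j : Q -> 'I_k) : merely {i | forall q, j q = i}.
Proof.
have ext i := dense_extend (fun q => kron R (j q) i).
apply: (merely_bind (finite_choice ext)) => a.
have na : ~ forall i, sval (a i) = 0.
  move=> a0; apply: dense_not_not => q; apply: local.1.
  by rewrite -(a0 (j q)) -(svalP (a (j q)) q) /kron eqxx.
apply: merely_map (not_all_zero na) => -[i /unit_neq0 ai]; exists i => q.
apply/eqP; apply: contraT => /negPf jq; case: ai.
by rewrite -(svalP (a i) q) /kron jq.
Qed.

(** A Zariski cover of the spectrum of [R/(r)] with nilpotent [r] has a member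
    which is everything, because [R/(r)] is local. *)
Lemma dense_choice (choice : ZariskiLocalChoice R) (B : Q -> Type) :
  (forall q, merely (B q)) -> merely (forall q, B q).
Proof.
move=> mB; apply: (merely_bind dQ) => -[m [r [_ Qr]]].
pose toQ (x : Spec (QuotAlg (const_poly r))) : Q := Qr.2 (closed_zero (zero_of_spec x)).
pose ofQ (q : Q) : Spec (QuotAlg (const_poly r)) :=
  spec_of_zero (exist _ (fun=> 0) (zero_closed (fun=> 0) (Qr.1 q))).
have c := choice _ (quot_presented (const_poly r)) (fun x => B (toQ x)) (fun x => mB _).
apply: (merely_bind c) => -[n [f [f1 s]]].
have ext i := dense_extend (fun q => value (f i) (ofQ q)).
apply: (merely_bind (finite_choice ext)) => a.
have na : ~ forall i, sval (a i) = 0.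
  move=> a0; apply: dense_not_not => q; apply: (merely_false f1) => -[d d1].
  have [h1 hD hM] := (svalP (ofQ q)).1; apply: local.1.
  rewrite -[LHS]h1 d1 (hom_sum (svalP (ofQ q)).1) big1 // => i _.
  by rewrite hM -/(value (f i) (ofQ q)) (svalP (a i) q) a0; apply: mul0r.
apply: merely_map (not_all_zero na) => -[i ai] q.
have ui : IsUnit (value (f i) (ofQ q)) by rewrite (svalP (a i) q).
have := s i (existT (fun x => IsUnit (value (f i) x)) (ofQ q) ui).
by rewrite /= (holds_hprop (toQ _) q).
Qed.

End Dense.

Section Extension.
Context (r : R).

Lemma poly_fraction (p : Poly R 1) :
  merely {a : R & {k : nat | forall u : IsUnit r, eval (fun=> sval u) p * power r k = a}}.
Proof.
move: p; apply: poly_ind => [p|i|a|p q mp mq|p q mp mq|p mp]; first exact: merely_hprop.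
- by apply: merely_intro; exists 1, 1%N => u; rewrite evalX /power /= mulr1 mulC; exact: (svalP u).
- by apply: merely_intro; exists a, 0%N => u; rewrite eval_scal /power /=; ring.
- apply: (merely_bind mp) => -[a [j ea]]; apply: merely_map mq => -[b [k eb]].
  exists (a * power r k + b * power r j), (j + k)%N => u.
  by rewrite powerD evalD -(ea u) -(eb u); ring.
- apply: (merely_bind mp) => -[a [j ea]]; apply: merely_map mq => -[b [k eb]].
  by exists (a * b), (j + k)%N => u; rewrite powerD evalM -(ea u) -(eb u); ring.
- apply: merely_map mp => -[a [j ea]].
  by exists (- a), j => u; rewrite evalN -(ea u); ring.
Qed.
(** Invertibility of [r] is the spectrum of [R[T] / (r T - 1)], so that [f] is a
    polynomial in [1 / r]; clear denominators. *)
Lemma open_fraction (f : IsUnit r -> R) :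
  merely {a : R & {k : nat | forall u, f u * power r k = a}}.
Proof.
pose P (j : 'I_1) : @Poly H R 1 := scal (Poly R 1) r * PolyX R ord0 - 1.
have zu (z : zeros P) : IsUnit r.
  exists (sval z ord0); apply: subr_eq0.
  by have := svalP z ord0; rewrite evalB evalM eval_scal evalX eval1.
have uz (u : IsUnit r) : forall j, eval (fun=> sval u) (P j) = 0.
  by move=> j; rewrite evalB evalM eval_scal evalX eval1 (svalP u) subrr.
apply: (merely_bind (duality_surj duality (fun z => f (zu z)))) => -[p fp].
apply: merely_map (poly_fraction p) => -[a [k e]]; exists a, k => u.
by rewrite -(e u) -(fp (exist _ _ (uz u))); congr (f _ * _); apply: IsUnit_hprop.
Qed.
End Extension.

(** Write [U] as the disjunction of the [r i <> 0]. On each of these [f] is a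
    fraction [a i / r i ^ k], so that [V] is the disjunction of the
    [r i * a i <> 0]. As [f] is given as a function, this needs duality only,
    while an arbitrary family of open propositions on [U] would need choice. *)
Lemma open_and_neq0 (U V : hProp) (f : U -> R) : IsOpenProp R U ->
  (V <-> exists u : U, f u <> 0) -> IsOpenProp R V.
Proof.
move=> oU Vf; apply: (merely_bind oU) => -[n [r Ur]].
have toU i (u : IsUnit (r i)) : U by apply/Ur/merely_intro; exists i; apply: unit_neq0.
have ext i := open_fraction (fun u => f (toU i u)).
apply: merely_map (finite_choice ext) => a.
exists n, (fun i => r i * projT1 (a i)); split.
- move/Vf=> [u fu]; have := Ur.1 u; apply: merely_map => -[i ri]; exists i.
  have ui := neq0_unit ri; apply/unit_neq0/(unit_mul ui).
  case: (a i) => /= b [k /(_ ui) <-]; apply: unit_mul.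
    by rewrite (holds_hprop (toU i ui) u); apply: neq0_unit.
  exact: unit_power.
- apply: merely_elim => [|[i /neq0_unit rai]]; first exact: holds_hprop.
  have ui := unit_factor rai; apply/Vf; exists (toU i ui) => f0.
  rewrite mulC in rai; have := unit_neq0 (unit_factor rai); apply.
  by case: (a i) => /= b [k /(_ ui) <-]; rewrite f0 mul0l.
Qed.

End Propositions.

(** * Unique lifting against propositions *)

Section Lifting.
Context {H : HoTT} (R : CommRing).
Add Ring R_ring : (cring_th R).

(** For sets [X] and propositions [Q] this says that [X -> X^Q] is an equivalence:
    injectivity, and a preimage of each map. *)
Definition lifts (Q : Prop) (X : Type) : Type :=
  ((forall x y : X, (Q -> x = y) -> x = y) * (forall f : Q -> X, {x | forall q, f q = x}))%type.

Definition etale (X : Type) : Type := forall Q : hProp, IsClosedDense R Q -> lifts Q X.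

Lemma etale_of_formally_etale X : IsFormallyEtale R X -> etale X.
Proof.
move=> eX Q dQ; have {eX dQ} e := eX Q dQ; split=> [x y Qxy|f].
  have [[z zy] zc] := e (fun=> y).
  have xy : (fun _ : Q => x) = (fun=> y) by apply: funext.
  have /(congr1 sval) /= <- := zc (exist (fun x => (fun _ : Q => x) = (fun=> y)) x xy).
  by have /(congr1 sval) := zc (exist (fun x => (fun _ : Q => x) = (fun=> y)) y erefl).
by have [[x xf] _] := e f; exists x => q; rewrite -xf.
Qed.

Lemma formally_etale_of_etale X : IsHSet X -> etale X -> IsFormallyEtale R X.
Proof.
move=> sX eX Q dQ f; have [inj ext] := eX Q dQ; have [x fx] := ext f.
have xf : (fun _ : Q => x) = f by apply: funext => q.
exists (exist _ x xf) => -[y yf]; apply: sig_eq => [z|/=].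
  by apply: hset_forall => q; apply: sX.
by apply: inj => q; rewrite -(fx q) -yf.
Qed.

Lemma lifts_bij Q X Y : Bij X Y -> lifts Q X -> lifts Q Y.
Proof.
move=> [f [g [fK gK]]] [inj ext]; split=> [x y xy|h].
  by apply: (can_inj gK); apply: inj => q; rewrite xy.
by have [x hx] := ext (g \o h); exists (f x) => q; rewrite -(hx q) /= gK.
Qed.

Lemma etale_bij X Y : Bij X Y -> etale X -> etale Y.
Proof. by move=> XY eX Q dQ; apply: lifts_bij XY (eX Q dQ). Qed.

Lemma lift_hprop (Q : Prop) X (f : Q -> X) : IsHSet X ->
  (forall x y : X, (Q -> x = y) -> x = y) -> IsHProp {x | forall q, f q = x}.
Proof.
move=> sX inj; apply: hprop_sig => [x|x y fx fy].
  by apply: hprop_forall => q; apply: sX.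
by apply: inj => q; rewrite -(fx q) -(fy q).
Qed.

Section Local.
Context (local : IsLocal R) (duality : Duality R).

(** An open proposition that holds under a closed dense hypothesis holds. *)
Lemma etale_open X (U : X -> hProp) : (forall x, IsOpenProp R (U x)) ->
  etale X -> etale {x | U x}.
Proof.
move=> oU eX Q dQ; have [inj ext] := eX Q dQ; split=> [u v uv|f].
  by apply: sig_eq => [x|]; [apply: holds_hprop|apply: inj => q; rewrite uv].
have [x fx] := ext (fun q => sval (f q)).
have Ux : U x by apply: (open_dense local duality dQ) => // q; rewrite -(fx q); exact: (svalP (f q)).
by exists (exist _ x Ux) => q; apply: sig_eq => [y|]; [apply: holds_hprop|apply: fx].
Qed.

(** A path from [x] to [y] is the image of a path in a piece containing [x],
    because the pieces are subtypes. *)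
Lemma hset_cover (C : Type -> Prop) X (c : FiniteOpenCover R C X) :
  (forall i : 'I_(cover_size c), IsHSet {x | piece i x}) -> IsHSet X.
Proof.
move=> sU x y.
have hpi : IsHProp (IsHProp (x = y)).
  move=> h h'; apply: funext => p; apply: funext => q.
  exact: (@hset_hprop _ h p q).
apply: (merely_elim _ _ (@piece_cover _ _ _ _ c x)) => // -[i ux] p q.
have lift z (w : piece i z) (r : x = z) :
    {s : exist (fun x => piece i x) x ux = exist _ z w | congr1 sval s = r}.
  by case: z / r w => w; rewrite (holds_hprop w ux); exists erefl.
have uy : piece i y by rewrite -p.
have [s <-] := lift y uy p; have [t <-] := lift y uy q.
by rewrite (sU i _ _ s t).
Qed.

(** A map [f] from a closed dense proposition to [X] meets, at each point, some
    piece of the cover; choice makes the piece a function of the point, and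
    this function is constant, so that [f] lands in a single piece. *)
Lemma etale_cover (choice : ZariskiLocalChoice R) (C : Type -> Prop) X
    (c : FiniteOpenCover R C X) : IsHSet X ->
  (forall i : 'I_(cover_size c), etale {x | piece i x}) -> etale X.
Proof.
move=> sX eU Q dQ.
have inj (x y : X) : (Q -> x = y) -> x = y.
  move=> xy; apply: (merely_elim _ _ (@piece_cover _ _ _ _ c x)); first exact: sX.
  move=> [i ux].
  have uy : piece i y.
    by apply: (open_dense local duality dQ); [apply: piece_open|move=> /xy <-].
  have [injU _] := eU i Q dQ.
  apply: (congr1 sval (injU (exist _ x ux) (exist _ y uy) _)) => q.
  by apply: sig_eq => [z|]; [apply: holds_hprop|apply: xy].
split=> // f.
have ch := dense_choice local duality dQ choice (fun q => @piece_cover _ _ _ _ c (f q)).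
apply: (merely_elim _ _ ch) => [|j]; first exact: lift_hprop.
have dc := dense_const local duality dQ (fun q => sval (j q)).
apply: (merely_elim _ _ dc) => [|[i ji]]; first exact: lift_hprop.
have fi q : piece i (f q) by rewrite -(ji q); apply: (svalP (j q)).
have [_ ext] := eU i Q dQ; have [u fu] := ext (fun q => exist _ (f q) (fi q)).
by exists (sval u) => q; rewrite -(fu q).
Qed.

End Local.
End Lifting.

(** * Standard étale schemes are étale *)

Section SquareZero.
Context {H : HoTT} (R : CommRing).
Add Ring R_ring : (cring_th R).

Lemma hprop_lifts Q X : IsHSet X -> IsHProp (lifts Q X).
Proof.
move=> sX [inj ext] [inj' ext'].
have -> : inj = inj' by do 3 (apply: hprop_forall => ?); apply: sX.
by have -> : ext = ext' by apply: hprop_forall => f; apply: lift_hprop.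
Qed.

(** A map on [Q2] is first extended to [Q1], where [Q1] may be assumed, and then
    to a point. *)
Lemma lifts_trans (Q1 Q2 : Prop) X :
  (Q2 -> Q1) -> lifts Q1 X -> (Q1 -> lifts Q2 X) -> lifts Q2 X.
Proof.
move=> Q21 [inj1 ext1] L2; split=> [x y xy|f].
  by apply: inj1 => u; have [inj2 _] := L2 u; apply: inj2.
have [x gx] := ext1 (fun u => sval ((L2 u).2 f)); exists x => q.
by rewrite -(gx (Q21 q)); apply: (svalP ((L2 (Q21 q)).2 f)).
Qed.

Lemma lifts_iff (Q Q' : Prop) X : IsHProp Q' -> (Q <-> Q') -> lifts Q X -> lifts Q' X.
Proof.
move=> hQ' [QQ' Q'Q] [inj ext]; split=> [x y xy|f]; first by apply: inj => /QQ'.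
have [x fx] := ext (fun q => f (QQ' q)); exists x => q.
by rewrite -(fx (Q'Q q)); congr f; apply: hQ'.
Qed.

Lemma lifts_true (Q : Prop) X : IsHProp Q -> Q -> lifts Q X.
Proof.
by move=> hQ q; split=> [x y /(_ q)|f] //; exists (f q) => q'; rewrite (hQ q' q).
Qed.

(** If [r ^ 2 ^ k.+1 = 0], one lifts against [r * r = 0] by induction and then,
    assuming [r * r = 0], against [r = 0]. *)
Lemma lifts_nilpotent X (r : R) :
  (forall e : R, e * e = 0 -> lifts (e = 0) X) -> forall k, power r (2 ^ k) = 0 -> lifts (r = 0) X.
Proof.
move=> L k; elim: k r => [|k IHk] r.
  by rewrite /power /= mulr1 => r0; apply: lifts_true => //; apply: car_set.
rewrite expnS mul2n -addnn -power_square => /IHk L1; apply: (lifts_trans _ L1) => [->|]; last exact: L.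
exact: mul0l.
Qed.

(** A closed dense proposition is a finite conjunction of equations [r i = 0]
    with [r i] nilpotent, treated one after the other. *)
Lemma etale_of_square_zero X : IsHSet X ->
  (forall e : R, e * e = 0 -> lifts (e = 0) X) -> etale R X.
Proof.
move=> sX L Q dQ; apply: (merely_elim _ _ dQ); first exact: hprop_lifts.
move=> [m [r [nil Qr]]]; apply: (@lifts_iff (forall i, r i = 0)).
- exact: holds_hprop.
- by split=> /Qr.
elim: m r nil {Qr} => [|m IHm] r nil.
  by apply: lifts_true => [|[]] //; apply: closed_hprop.
apply: (@lifts_trans (forall i, r (lift ord0 i) = 0)) => [r0 i|| r0] //.
  by apply: IHm.
apply: (@lifts_iff (r ord0 = 0)).
- exact: closed_hprop.
- by split=> [r00 i|]; [case: (unliftP ord0 i) => [j ->|->]|].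
apply: (merely_elim _ _ (nil ord0)); first exact: hprop_lifts.
move=> [k rk]; apply: (@lifts_nilpotent _ _ L k).
by rewrite -(subnKC (ltnW (ltn_expl k (ltnSn 1)))) powerD rk mul0l.
Qed.

End SquareZero.

Section StandardEtale.
Context {H : HoTT} (R : CommRing).
Add Ring R_ring : (cring_th R).
Context (local : IsLocal R) (duality : Duality R).

Lemma dense_eq0 (r : R) : IsNilpotent r -> IsClosedDense R (HProp (@car_set R r 0)).
Proof.
move=> nr; apply: merely_intro; exists 1%N, (fun=> r).
by split=> //; split=> [//|/(_ ord0)].
Qed.

Lemma square_zero_dense (e : R) : e * e = 0 -> IsClosedDense R (HProp (@car_set R e 0)).
Proof.
by move=> ee; apply/dense_eq0/merely_intro; exists 2%N; rewrite /power /= mulr1.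
Qed.

Lemma eq0_multiple (e a : R) : (e = 0 -> a = 0) -> merely {c | a = e * c}.
Proof.
move=> ea; have ea' : (forall j : 'I_1, (fun=> e) j = 0) -> a = 0 by move/(_ ord0).
by apply: merely_map (closed_ideal duality ea') => -[c ->]; exists (c ord0); rewrite big_ord1 mulC.
Qed.

(** The Jacobian condition, read pointwise; by duality this is invertibility of
    the determinant in the quotient algebra. *)
Definition standard n (P : 'I_n -> Poly R n) : Type :=
  forall z : zeros P, IsUnit (det (jac P (sval z))).

(** Infinitesimal Newton step: [P (x + e h) = P x + e J h] when [e * e = 0], and
    the Jacobian matrix [J] is invertible. *)
Lemma standard_lifts n (P : 'I_n -> Poly R n) (e : R) : standard P -> e * e = 0 ->
  lifts (e = 0) (zeros P).
Proof.
move=> sP ee.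
have inj (z w : zeros P) : (e = 0 -> z = w) -> z = w.
  move=> zw; have d i : merely {c | sval w i - sval z i = e * c}.
    by apply: eq0_multiple => /zw ->; apply: subrr.
  apply: (merely_elim _ _ (finite_choice d)) => [|h']; first exact: hset_zeros.
  have [h hE] : {h | forall i, sval w i - sval z i = e * h i}.
    by exists (fun i => sval (h' i)) => i; exact: (svalP (h' i)).
  have wE : sval w = (fun i => sval z i + e * h i).
    by apply: funext => i; rewrite -hE; ring.
  (* The difference [e h] is in the kernel of the Jacobian matrix. *)
  have k0 : forall i, \big[add/0]_j (jac P (sval z) i j * (e * h j)) = 0.
    move=> i; have := svalP w i; rewrite wE (eval_taylor _ _ _ ee) (svalP z i) add0; apply: etrans.
    by rewrite big_distrr /=; apply: eq_bigr => j _; rewrite /jac; ring.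
  apply: sig_eq => [x|]; first by apply: hprop_forall => j; apply: car_set.
  by rewrite wE; apply: funext => i; rewrite (unit_cancel (sP z) (det_mul_kernel k0 i)) addr0.
split=> // f.
have dQ := square_zero_dense ee.
have ext i := dense_extend duality dQ (fun q : e = 0 => sval (f q) i).
apply: (merely_elim _ _ (finite_choice ext)) => [|xs].
  by apply: lift_hprop => //; apply: hset_zeros.
pose x i := sval (xs i).
have fx q : sval (f q) = x by apply: funext => i; apply: (svalP (xs i)).
have c i : merely {c | eval x (P i) = e * c}.
  by apply: eq0_multiple => q; rewrite -(fx q) (svalP (f q)).
apply: (merely_elim _ _ (finite_choice c)) => [|{}c].
  by apply: lift_hprop => //; apply: hset_zeros.
have ux : IsUnit (det (jac P x)).
  by apply: (unit_dense local duality dQ) => q; rewrite -(fx q).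
(* The error of [x] is [e c]; it is corrected by [h = - J^-1 c]. *)
have [h hE] := unit_det_solve (fun i => - sval (c i)) ux.
have y0 i : eval (fun j => x j + e * h j) (P i) = 0.
  by rewrite (eval_taylor _ _ _ ee) (svalP (c i)) [X in _ + e * X]hE; ring.
exists (exist _ _ y0) => q; apply: sig_eq => [y|/=].
  by apply: hprop_forall => j; apply: car_set.
by rewrite (fx q); apply: funext => i; rewrite q; ring.
Qed.

Lemma standard_etale n (P : 'I_n -> Poly R n) : standard P -> etale R (zeros P).
Proof. by move=> sP; apply: etale_of_square_zero => [|e ee]; [apply: hset_zeros|apply: standard_lifts]. Qed.

(** The inverses of the values form a function, hence an element of the algebra,
    and its product with [p] is [1] because all values are. *)
Lemma unit_pointwise n l (P : 'I_l -> Poly R n) (p : Poly R n) :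
  (forall z : zeros P, IsUnit (eval (sval z) p)) -> IsUnit (quot_proj P p).
Proof.
move=> up; have := duality_surj duality (fun z => sval (up z)).
apply: merely_elim => [|[q qE]]; first exact: IsUnit_hprop.
exists (quot_proj P q); have [h1 hD hM] := quot_proj_hom P.
have pq (z : zeros P) : eval (sval z) (p * q - 1) = 0.
  by rewrite evalB evalM -qE (svalP (up z)) eval1 subrr.
rewrite -hM -h1; apply: (class_eq (eq_mod_equiv P)).
exact: duality_inj pq.
Qed.

Lemma det_jac n (P : 'I_n -> Poly R n) (z : zeros P) :
  det (jac P (sval z)) = eval (sval z) (det (fun i j => pderiv j (P i))).
Proof. by rewrite (hom_det (eval_hom _)). Qed.

Lemma is_standard_etale X n (P : 'I_n -> Poly R n) :
  standard P -> Bij X (zeros P) -> IsStandardEtale R X.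
Proof.
move=> sP XP; apply: merely_intro; exists n, P; split.
  rewrite -(hom_det (quot_proj_hom P)); apply: unit_pointwise => z.
  by rewrite -det_jac.
by apply: equiv_of_bij; [apply: hset_spec|apply: bij_trans XP (bij_sym (spec_bij P))].
Qed.

Lemma standard_etale_zeros X : IsStandardEtale R X ->
  merely {n : nat & {P : 'I_n -> Poly R n & (standard P * Bij X (zeros P))%type}}.
Proof.
apply: merely_map => -[n [P [u /bij_of_equiv XP]]]; exists n, P; split.
  move=> z; rewrite det_jac -zero_homE (hom_det (quot_proj_hom P)).
  exact: (hom_unit (zero_hom_spec z).1).
exact: bij_trans XP (spec_bij P).
Qed.

End StandardEtale.

(** * Inverting a function on a zero locus *)

Section Rabinowitsch.
Context {H : HoTT} (R : CommRing).
Add Ring R_ring : (cring_th R).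
Context (local : IsLocal R) (duality : Duality R).
Context (n : nat).

Definition weaken (p : Poly R n) : Poly R n.+1 :=
  subst (B := Poly R n.+1) (fun i => PolyX R (lift ord_max i)) p.

Lemma eval_weaken (x : 'I_n.+1 -> R) p :
  eval x (weaken p) = eval (fun i => x (lift ord_max i)) p.
Proof.
move: p; apply: poly_eq => [|i|r|p q ep eq|p q ep eq|p ep]; first exact: car_set.
- by rewrite /weaken substX !evalX.
- by rewrite /weaken subst_scal !eval_scal.
- by rewrite /weaken (hom_add (subst_hom _)) !evalD -/(weaken p) -/(weaken q) ep eq.
- by rewrite /weaken (hom_mul (subst_hom _)) !evalM -/(weaken p) -/(weaken q) ep eq.
- by rewrite /weaken (hom_opp (subst_hom _)) !evalN -/(weaken p) ep.
Qed.

Lemma eval_pderiv_weaken (x : 'I_n.+1 -> R) j p :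
  eval x (pderiv j (weaken p)) =
  if unlift ord_max j is Some k then eval (fun i => x (lift ord_max i)) (pderiv k p) else 0.
Proof.
move: p; apply: poly_eq => [|i|r|p q ep eq|p q ep eq|p ep]; first exact: car_set.
- rewrite /weaken substX pderivX; case: unliftP => [k ->|->].
    by rewrite pderivX (inj_eq lift_inj); case: eqP; rewrite ?eval0 ?eval1.
  by rewrite eq_sym (negPf (neq_lift _ _)) eval0.
- by rewrite /weaken subst_scal pderiv_scal eval0; case: unlift => // k; rewrite pderiv_scal eval0.
- rewrite /weaken (hom_add (subst_hom _)) pderivD evalD -/(weaken p) -/(weaken q) ep eq.
  by case: unlift => [k|]; rewrite ?pderivD ?evalD //; ring.
- rewrite /weaken (hom_mul (subst_hom _)) pderivM evalD !evalM -/(weaken p) -/(weaken q) ep eq.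
  by rewrite !eval_weaken; case: unlift => [k|]; rewrite ?pderivM ?evalD ?evalM //; ring.
- rewrite /weaken (hom_opp (subst_hom _)) pderivN evalN -/(weaken p) ep.
  by case: unlift => [k|]; rewrite ?pderivN ?evalN //; ring.
Qed.

Context (P : 'I_n -> Poly R n) (G : Poly R n).

(** [R[X, T] / (P, T G - 1)], a presentation of the localization at [G] with
    again as many equations as variables. *)
Definition invert (i : 'I_n.+1) : Poly R n.+1 :=
  if unlift ord_max i is Some k then weaken (P k) else PolyX R ord_max * weaken G - 1.

Lemma invert_zero (w : zeros invert) : forall k, eval (fun i => sval w (lift ord_max i)) (P k) = 0.
Proof. by move=> k; have := svalP w (lift ord_max k); rewrite /invert liftK eval_weaken. Qed.

Lemma invert_inv (w : zeros invert) : eval (fun i => sval w (lift ord_max i)) G * sval w ord_max = 1.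
Proof.
have := svalP w ord_max; rewrite /invert unlift_none evalB evalM evalX eval1 eval_weaken mulC.
exact: subr_eq0.
Qed.

Definition invert_proj (w : zeros invert) : zeros P := exist _ _ (invert_zero w).

Lemma invert_unit (w : zeros invert) : IsUnit (eval (sval (invert_proj w)) G).
Proof. by exists (sval w ord_max); apply: invert_inv. Qed.

Lemma invert_bij : Bij (zeros invert) {z : zeros P | eval (sval z) G <> 0}.
Proof.
exists (fun w => exist _ (invert_proj w) (unit_neq0 local (invert_unit w))).
pose x (z : {z : zeros P | eval (sval z) G <> 0}) i :=
  if unlift ord_max i is Some k then sval (sval z) k else sval (neq0_unit local duality (svalP z)).
have xl z : (fun i => x z (lift ord_max i)) = sval (sval z).
  by apply: funext => i; rewrite /x liftK.
have x0 z i : eval (x z) (invert i) = 0.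
  rewrite /invert; case: unliftP => [k _|_]; first by rewrite eval_weaken xl (svalP (sval z)).
  rewrite evalB evalM evalX eval1 eval_weaken xl /x unlift_none mulC.
  by rewrite (svalP (neq0_unit local duality (svalP z))) subrr.
exists (fun z => exist _ (x z) (x0 z)); split=> [w|z].
  apply: sig_eq => [y|]; first by apply: hprop_forall => j; apply: car_set.
  apply: funext => i; rewrite /= /x; case: unliftP => [k ->|->] //.
  set u := neq0_unit _ _ _.
  by have -> : u = exist _ _ (invert_inv w) by apply: IsUnit_hprop.
apply: sig_eq => [y|]; first by apply: hprop_forall => ?; case.
apply: sig_eq => [y|]; first by apply: hprop_forall => j; apply: car_set.
exact: xl.
Qed.

Lemma det_invert (x : 'I_n.+1 -> R) (y := fun i => x (lift ord_max i)) :
  det (jac invert x) = det (jac P y) * eval y G.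
Proof.
rewrite det_last_col => [|i]; last by rewrite /jac /invert liftK eval_pderiv_weaken unlift_none.
congr (_ * _); first by apply: eq_det => i j; rewrite /jac /invert liftK eval_pderiv_weaken liftK.
rewrite /jac /invert unlift_none (_ : _ - 1 = PolyX R ord_max * weaken G + - (1)) //.
have d1 : pderiv ord_max (1 : @Poly H R n.+1) = 0 := pderiv_scal _ 1.
rewrite pderivD pderivN d1 pderivM pderivX eqxx evalD evalN eval0 evalD !evalM eval1.
by rewrite eval_pderiv_weaken unlift_none eval_weaken -/y; ring.
Qed.

(** The last column of the Jacobian matrix of [invert] is zero except for the
    entry [G], which the last equation makes invertible. *)
Lemma standard_invert : (forall z : zeros P, eval (sval z) G <> 0 -> IsUnit (det (jac P (sval z)))) ->
  standard invert.
Proof.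
move=> u w; rewrite det_invert; apply: unit_mul (invert_unit w).
exact: (u (invert_proj w) (unit_neq0 local (invert_unit w))).
Qed.

End Rabinowitsch.

(** * Étale zero loci are locally standard étale *)

Section McCoy.
Context (R : CommRing) (l n : nat) (M : 'I_l -> 'I_n -> R).
Hypothesis kerM : forall v, (forall i, \big[add/0]_j (M i j * v j) = 0) -> forall j, v j = 0.

(** McCoy's theorem. If all minors on the first [k + 1] columns vanish, so do
    those on the first [k]: the cofactors along an additional row form a vector
    [v] with [M v = 0], because the entries of [M v] are minors on [k + 1] columns,
    and the last entry of [v] is the given minor. Descending from [k = n] one
    reaches the empty minor, which is [1]. A minor on [k] columns is written as a
    determinant of size [n], completed with rows of the identity. *)
Lemma injective_minor : (forall s : 'I_n -> 'I_l, det (fun i j => M (s i) j) = 0) -> 1 = 0 :> R.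
Proof.
move=> M0.
(* Here [k] counts the completing rows of the identity, so that it goes up. *)
suff D k : (k <= n)%N -> forall w : 'I_n -> 'I_n -> R,
    (forall i : 'I_n, (i < n - k)%N -> {a | w i = M a}) ->
    (forall i : 'I_n, (n - k <= i)%N -> w i = kron R i) -> det w = 0.
  rewrite -(det_kron R n); apply: (D n) => // i; by rewrite subnn.
elim: k => [|k IHk] kn w wM wI.
  have wM' i : {a | w i = M a} by apply: wM; rewrite subn0.
  by rewrite -[RHS](M0 (fun i => sval (wM' i))); apply: eq_det => i j; rewrite -(svalP (wM' i)).
have lt_n : (n - k.+1 < n)%N by rewrite ltn_subrL (leq_trans _ kn).
pose r := Ordinal lt_n.
have nk : (n - k = (n - k.+1).+1)%N by rewrite -subSn.
rewrite -[RHS](kerM (v := cofactor w r) _ r) => [|i].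
  rewrite /cofactor; apply: eq_det => i j; rewrite /set_row; case: eqP => // ->.
  by rewrite wI.
rewrite expand_row; apply: IHk => [|j|j]; first exact: ltnW.
  rewrite nk ltnS /set_row => jk; case: (eqVneq j r) => [_|jr]; first by exists i.
  by apply: wM; rewrite ltn_neqAle jk andbT.
rewrite nk /set_row => jk; rewrite -(wI j) 1?ltnW //.
by case: eqP jk => [->|//]; rewrite ltnn.
Qed.

End McCoy.

Section EtaleZeros.
Context {H : HoTT} (R : CommRing).
Add Ring R_ring : (cring_th R).
Context (local : IsLocal R) (duality : Duality R).

(** Apply duality to [R[X] / (X * X)], whose points are the [e] of square zero:
    the polynomial [a X] vanishes there, so it is a multiple of [X * X], and its
    derivative at [0] is [a]. *)
Lemma square_zero_faithful (a : R) : (forall e : R, e * e = 0 -> e * a = 0) -> a = 0.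
Proof.
move=> ea.
pose P (j : 'I_1) : @Poly H R 1 := PolyX R ord0 * PolyX R ord0.
pose p : @Poly H R 1 := PolyX R ord0 * scal (Poly R 1) a.
have p0 (z : zeros P) : eval (sval z) p = 0.
  rewrite /p evalM evalX eval_scal; apply: ea.
  by have := svalP z ord0; rewrite evalM evalX.
apply: (merely_elim _ _ (duality_inj duality p0)) => [|[c pc]]; first exact: car_set.
have := congr1 (fun q => eval (fun=> 0) (pderiv ord0 q)) pc.
rewrite big_ord1 !pderivM pderivX pderiv_scal eqxx !(evalD, evalM, evalX, eval0, eval1, eval_scal).
by move=> e; transitivity (1 * a + 0 * 0); [ring|rewrite e; ring].
Qed.

Section Fixed.
Context (n l : nat) (P : 'I_l -> Poly R n) (eP : etale R (zeros P)).

(** The points [z] and [z + e v] of the zero locus agree where [e = 0], so they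
    are equal for every [e] of square zero. *)
Lemma etale_tangent (z : zeros P) (v : 'I_n -> R) :
  (forall i, \big[add/0]_j (jac P (sval z) i j * v j) = 0) -> forall j, v j = 0.
Proof.
move=> Jv j; apply: square_zero_faithful => e ee.
have y0 i : eval (fun k => sval z k + e * v k) (P i) = 0.
  by rewrite (eval_taylor _ _ _ ee) (svalP z i) [X in _ + e * X]Jv; ring.
have [inj _] := eP (square_zero_dense ee).
have /(congr1 (fun y => sval y j)) /= yz : exist _ _ y0 = z.
  apply: inj => /= e0; apply: sig_eq => [y|/=]; first by apply: hprop_forall => i; apply: car_set.
  by apply: funext => k; rewrite e0; ring.
by transitivity ((sval z j + e * v j) - sval z j); [ring|rewrite yz; ring].
Qed.

Definition minor (s : 'I_n -> 'I_l) : Poly R n := det (fun i j => pderiv j (P (s i))).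

Lemma etale_minor (z : zeros P) :
  merely {s : {ffun 'I_n -> 'I_l} | eval (sval z) (minor s) <> 0}.
Proof.
have nz : ~ forall s : {ffun 'I_n -> 'I_l}, eval (sval z) (minor s) = 0.
  move=> m0; apply: local.1; apply: (injective_minor (etale_tangent (z := z))) => s.
  rewrite -[RHS](m0 [ffun i => s i]) /minor (hom_det (eval_hom _)).
  by apply: eq_det => i j; rewrite ffunE.
by apply: merely_map (not_all_zero_fin local duality nz) => -[s /(unit_neq0 local) ?]; exists s.
Qed.

End Fixed.

(** Where all products [r i * r k] vanish, the proposition [r = 0] is closed dense
    and implies itself, so it holds. By duality the [r j] lie in the square of
    the ideal they generate, that is [r = A r] with the entries of [A] in this
    ideal. As in Nakayama's lemma, [det (1 - A)] annihilates [r], while it is [1]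
    where [r = 0]. By locality [det (1 - A)] or [1 - det (1 - A)] is invertible:
    in the first case [r = 0], in the second [r = 0] is impossible. *)
Lemma etale_closed_decidable l (r : 'I_l -> R) :
  (forall Q : hProp, IsClosedDense R Q -> (Q -> forall j, r j = 0) -> forall j, r j = 0) ->
  (forall j, r j = 0) + ~ (forall j, r j = 0).
Proof.
move=> er.
have hC : IsHProp (forall j, r j = 0) by exact: closed_hprop.
have hdec : IsHProp ((forall j, r j = 0) + ~ (forall j, r j = 0))%type.
  by apply: hprop_sum => //; apply: hprop_forall => ?; case.
have sq j : merely {c : 'I_l * 'I_l -> R | r j = \big[add/0]_x (c x * (r x.1 * r x.2))}.
  apply: closed_ideal_fin => // rr; apply: (er (HProp hC)) => //.
  apply: merely_intro; exists l, r; split=> // i; apply: merely_intro; exists 2%N.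
  by rewrite /power /= mulr1; apply: (rr (i, i)).
apply: (merely_elim _ _ (finite_choice sq)) => // c.
pose A j k := \big[add/0]_i (sval (c j) (i, k) * r i).
pose d := det (fun j k => kron R j k - A j k).
have rA j : r j = \big[add/0]_k (A j k * r k).
  rewrite {1}(svalP (c j)); under [RHS]eq_bigr do rewrite big_distrl.
  rewrite exchange_big /= pair_bigA /=; apply: eq_bigr => -[i k] _ /=; ring.
have dr : forall j, d * r j = 0.
  apply: det_mul_kernel => j; rewrite -[RHS](subrr (r j)) {2}rA -{1}(sum_kron j r).
  transitivity (\big[add/0]_k (kron R j k * r k) + opp 1 * \big[add/0]_k (A j k * r k)); last by ring.
  by rewrite big_distrr -big_split /=; apply: eq_bigr => k _; ring.
have : IsUnit (d + (1 - d)) by exists 1; ring.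
move/local.2; apply: merely_elim => // -[ud|u1d].
  by left=> j; apply: unit_cancel ud (dr j).
right=> r0; apply: (unit_neq0 local u1d).
rewrite /d -(det_kron R l) (eq_det (N := kron R (n := l))) ?subrr // => j k.
rewrite /A big1 => [|i _]; last by rewrite (r0 i); ring.
by ring.
Qed.

Section Fixed.
Context (n l : nat) (P : 'I_l -> Poly R n) (eP : etale R (zeros P)) (s : 'I_n -> 'I_l).

Local Notation Y := {z : zeros (fun i => P (s i)) | eval (sval z) (minor P s) <> 0}.

(** Let [Y] be the locus where the equations chosen by [s] hold and their minor is
    invertible. It is étale, and so is the locus in question, which is closed in
    [Y]; its membership proposition is therefore étale and closed, hence
    decidable. Its characteristic function is a polynomial on [Y] by duality, and
    inverting this polynomial cuts out the locus without spoiling the balance of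
    equations and variables. *)
Lemma etale_minor_standard :
  IsStandardEtale R {z : zeros P | eval (sval z) (minor P s) <> 0}.
Proof.
pose G := minor P s.
pose P1 := invert (fun i => P (s i)) G.
have sP1 : standard P1.
  apply: standard_invert => // z /(neq0_unit local duality); rewrite /G /minor.
  by rewrite (hom_det (eval_hom _)).
have eP1 := standard_etale local duality sP1.
pose b : Bij (zeros P1) _ := invert_bij local duality (fun i => P (s i)) G.
have eY := etale_bij b (standard_etale local duality sP1).
pose pt (y : Y) := sval (sval y).
pose C (y : Y) := forall j, eval (pt y) (P j) = 0.
have dec y : C y + ~ C y.
  apply: etale_closed_decidable => Q dQ Cy.
  have [z Qz] := (eP dQ).2 (fun q => exist _ (pt y) (Cy q)).
  have ptz (q : Q) : pt y = sval z by rewrite -(Qz q).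
  have Gz : eval (sval z) G <> 0.
    apply/(unit_neq0 local)/(unit_dense local duality dQ) => q; rewrite -(ptz q).
    exact/(neq0_unit local duality)/(svalP y).
  pose z' : zeros (fun i => P (s i)) :=
    exist (fun x => forall i, eval x (P (s i)) = 0) (sval z) (fun i => svalP z (s i)).
  (* The lift [z] lies in [Y] too, where lifts are unique. *)
  suff -> : y = exist _ z' Gz by apply: (svalP z).
  apply: (eY Q dQ).1 => q; apply: sig_eq => [x|]; first by apply: hprop_forall => ?; case.
  by apply: sig_eq => [x|]; [apply: hprop_forall => j; apply: car_set|apply: ptz].
pose chi y : R := if dec y then 1 else 0.
have chiE y : chi y <> 0 <-> C y.
  by rewrite /chi; case: (dec y) => [Cy|nCy]; split=> // _; apply: local.1.
apply: (merely_elim _ _ (duality_surj duality (fun w => chi (projT1 b w)))).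
  exact: merely_hprop.
move=> [E chiwE]; apply: (is_standard_etale duality (P := invert P1 E)).
  by apply: standard_invert => // w _; apply: sP1.
apply: bij_sym; apply: (bij_trans (invert_bij local duality P1 E)).
have neq_hprop (x : R) : IsHProp (x <> 0) by apply: hprop_forall => ?; case.
have C_hprop y : IsHProp (C y) by apply: hprop_forall => j; apply: car_set.
apply: (bij_trans (bij_sig (Q := C) (e := b) _ _ _)) => [w|y|w|] //.
  by rewrite -chiwE; apply: chiE.
exists (fun y : {y | C y} => exist _ (exist _ (pt (sval y)) (svalP y)) (svalP (sval y))).
pose back (z : {z : zeros P | eval (sval z) G <> 0}) : Y :=
  exist _ (exist (fun x => forall i, eval x (P (s i)) = 0) (sval (sval z))
    (fun i => svalP (sval z) (s i))) (svalP z).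
exists (fun z => exist C (back z) (svalP (sval z))).
have zeros_hprop m (p : 'I_m -> Poly R n) x : IsHProp (forall j, eval x (p j) = 0).
  by apply: hprop_forall => j; apply: car_set.
split=> [y|z]; last by do 2 apply: sig_eq => //.
by do 3 apply: sig_eq => //.
Qed.

End Fixed.

End EtaleZeros.

(** * The characterization of étale schemes *)

Section Main.
Context {H : HoTT} (R : CommRing).
Context (local : IsLocal R) (duality : Duality R) (choice : ZariskiLocalChoice R).

Lemma hprop_hset X : IsHProp (IsHSet X).
Proof.
move=> h h'; do 4 (apply: funext => ?).
by apply: hset_hprop => ? ?; apply: h.
Qed.

Lemma hprop_etale X : IsHSet X -> IsHProp (etale R X).
Proof. by move=> sX; do 2 (apply: hprop_forall => ?); apply: hprop_lifts. Qed.

Lemma standard_etale_hset X : IsStandardEtale R X -> IsHSet X.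
Proof.
move/(standard_etale_zeros); apply: merely_elim; first exact: hprop_hset.
by move=> [n [P [_ XP]]]; apply: (hset_bij XP); apply: hset_zeros.
Qed.

Lemma standard_etale_etale X : IsStandardEtale R X -> etale R X.
Proof.
move=> stX; have sX := standard_etale_hset stX.
apply: (merely_elim _ _ (standard_etale_zeros stX)); first exact: hprop_etale.
by move=> [n [P [sP XP]]]; apply: etale_bij (bij_sym XP) (standard_etale local duality sP).
Qed.

Lemma formally_etale_of_cover X :
  merely (FiniteOpenCover R (IsStandardEtale R) X) -> IsFormallyEtale R X.
Proof.
move=> mc.
have sX : IsHSet X.
  apply: (merely_elim _ _ mc) => [|c]; first exact: hprop_hset.
  by apply: (@hset_cover _ _ _ _ c) => i; apply: standard_etale_hset (piece_in i).
apply: formally_etale_of_etale => //.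
apply: (merely_elim _ _ mc) => [|c]; first exact: hprop_etale.
by apply: (@etale_cover _ _ local duality choice _ _ c) => // i; apply: standard_etale_etale (piece_in i).
Qed.

Lemma is_standard_etale_bij X Y : Bij X Y -> IsStandardEtale R Y -> IsStandardEtale R X.
Proof.
move=> XY; apply: merely_map => -[n [P [u /bij_of_equiv YP]]]; exists n, P; split=> //.
by apply: equiv_of_bij; [apply: hset_spec|apply: bij_trans XY YP].
Qed.

Section Refinement.
Context (X : Type) (eX : etale R X) (U : X -> hProp) (oU : forall x, IsOpenProp R (U x)).
Context (n l : nat) (P : 'I_l -> Poly R n) (b : Bij {x | U x} (zeros P)).

Definition minor_at (s : 'I_n -> 'I_l) (x : X) (u : U x) : R :=
  eval (sval (projT1 b (exist _ x u))) (minor P s).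

Lemma minor_piece_hprop (s : 'I_n -> 'I_l) x : IsHProp (exists u : U x, minor_at s u <> 0).
Proof.
move=> [u hu] [v hv]; case: _ / (holds_hprop u v) hv => hv.
by congr ex_intro; apply: hprop_forall => ?; case.
Qed.

Definition minor_piece (s : 'I_n -> 'I_l) (x : X) : hProp := HProp (@minor_piece_hprop s x).

Lemma minor_piece_open s x : IsOpenProp R (minor_piece s x).
Proof. exact: (open_and_neq0 local duality (f := @minor_at s x) (oU x)). Qed.

Lemma minor_piece_cover x : U x -> merely {s : {ffun 'I_n -> 'I_l} | minor_piece s x}.
Proof.
move=> u; have eP := etale_bij b (etale_open local duality oU eX).
by apply: merely_map (etale_minor local duality eP (projT1 b (exist _ x u))) => -[s hs]; exists s, u.
Qed.

Lemma minor_piece_standard s : IsStandardEtale R {x | minor_piece s x}.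
Proof.
have eP := etale_bij b (etale_open local duality oU eX).
apply: is_standard_etale_bij (etale_minor_standard local duality eP s).
have neq_hprop (x : R) : IsHProp (x <> 0) by apply: hprop_forall => ?; case.
apply: (@bij_trans _ {y | eval (sval (projT1 b y)) (minor P s) <> 0}); last first.
  exact: (bij_sig (e := b)).
have inU x : minor_piece s x -> U x by case.
have in_neq0 x (m : minor_piece s x) : minor_at s (inU x m) <> 0.
  by case: m => u hu; rewrite (holds_hprop (inU x _) u).
exists (fun y => exist _ (exist _ (sval y) (inU _ (svalP y))) (in_neq0 _ (svalP y))).
have back (y : {y | eval (sval (projT1 b y)) (minor P s) <> 0}) : minor_piece s (sval (sval y)).
  by case: y => -[x u] hu; exists u.
exists (fun y => exist _ (sval (sval y)) (back y)); split=> y.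
  by apply: sig_eq => // x; apply: holds_hprop.
apply: sig_eq => [x|]; first exact: neq_hprop.
by apply: sig_eq => // x; apply: holds_hprop.
Qed.

End Refinement.

Lemma standard_cover X : IsScheme R X -> etale R X ->
  merely (FiniteOpenCover R (IsStandardEtale R) X).
Proof.
move=> sch eX; apply: (merely_bind sch) => c.
apply: merely_map (finite_choice (fun i => affine_zeros (@piece_in _ _ _ _ c i))) => d.
pose n i := projT1 (d i); pose l i := projT1 (projT2 (d i)).
pose b i := projT2 (projT2 (projT2 (d i))).
pose K : finType := {i : 'I_(cover_size c) & {ffun 'I_(n i) -> 'I_(l i)}}.
pose pc (a : K) := minor_piece (b (tag a)) (tagged a).
have pc_open a x : IsOpenProp R (pc a x) by apply: minor_piece_open; apply: piece_open.
have pc_cover x : merely {a | pc a x}.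
  apply: (merely_bind (@piece_cover _ _ _ _ c x)) => -[i u].
  have := minor_piece_cover eX (@piece_open _ _ _ _ c i) (b i) u.
  by apply: merely_map => -[s hs]; exists (Tagged (fun i => {ffun 'I_(n i) -> 'I_(l i)}) s).
have pc_in a : IsStandardEtale R {x | pc a x}.
  exact: (minor_piece_standard eX (@piece_open _ _ _ _ c (tag a)) (b (tag a)) (tagged a)).
exists #|K| (fun k => pc (enum_val k)) => [k x|x|k] //.
by apply: merely_map (pc_cover x) => -[a ha]; exists (enum_rank a); rewrite enum_rankK.
Qed.

End Main.

Theorem corollary4p4p2 (H : HoTT) (R : CommRing)
  (local : IsLocal R) (duality : Duality R) (choice : ZariskiLocalChoice R)
  (X : Type) (scheme : IsScheme R X) :
  iffT (IsEtaleScheme R X) (merely (FiniteOpenCover R (IsStandardEtale R) X)).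
Proof.
split=> [[_ eX]|c].
  exact (standard_cover local duality scheme (etale_of_formally_etale eX)).
by split=> //; apply: formally_etale_of_cover.
Qed.
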